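(* Let $L/K$ be a finite unramified extension of $p$-adic fields and let $H$ be a Hopf algebra giving a Hopf-Galois structure on $L/K$. Let $\mathfrak{A}_H = \{h \in H \mid h\cdot x \in \mathfrak{O}_L \text{ for all } x \in \mathfrak{O}_L\}$ be the associated order of $\mathfrak{O}_L$ in $H$. Then $\mathfrak{O}_L$ is a free $\mathfrak{A}_H$-module.
   Context: A $p$-adic field is a finite extension of $\mathbb{Q}_p$; $\mathfrak{O}_L$ denotes the valuation ring of $L$. Hopf-Galois structures: let $L/K$ be a finite separable field extension and $H$ a finite-dimensional $K$-Hopf algebra with counit $\varepsilon$ and comultiplication $\Delta(h)=\sum_{(h)} h_{(1)}\otimes h_{(2)}$. $L$ is an $H$-module algebra if $L$ is an $H$-module with $h\cdot(st)=\sum_{(h)}(h_{(1)}\cdot s)(h_{(2)}\cdot t)$ and $h\cdot 1=\varepsilon(h)1$ for all $h\in H$, $s,t\in L$. We say $H$ gives a Hopf-Galois structure on $L/K$ (or $L/K$ is $H$-Galois) if $L$ is an $H$-module algebra and the $K$-linear map $j: L\otimes_K H\to \mathrm{End}_K(L)$, $j(s\otimes h)(t)=s(h\cdot t)$, is an isomorphism. *)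

(* Defs.v *)
From HB Require Import structures.
From mathcomp Require Import all_boot all_order all_algebra all_field.

Set Implicit Arguments.
Unset Strict Implicit.
Unset Printing Implicit Defensive.

Import Order.TTheory GRing.Theory Num.Theory.
Local Open Scope ring_scope.

(** * Valuations *)

(* Exponential rational-valued valuations.  The convention is v(0) = +oo: the
   value of the function [v] at 0 is never used, and [val_ge v c x] is the
   relation c <= v(x) that includes x = 0. *)
Definition valuation (F : fieldType) (v : F -> rat) : Prop :=
  (forall x y, x != 0 -> y != 0 -> v (x * y) = v x + v y) /\
  (forall x y, x != 0 -> y != 0 -> x + y != 0 ->
     Num.min (v x) (v y) <= v (x + y)).

Definition val_ge (F : fieldType) (v : F -> rat) (c : rat) : pred F :=
  fun x => (x == 0) || (c <= v x).

Definition valuation_ring (F : fieldType) (v : F -> rat) : pred F :=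
  val_ge v 0.

Definition val_cauchy (F : fieldType) (v : F -> rat) (u : nat -> F) : Prop :=
  forall c : rat, exists N : nat, forall m n : nat,
    (N <= m)%N -> (N <= n)%N -> val_ge v c (u m - u n).

Definition val_cvg (F : fieldType) (v : F -> rat) (u : nat -> F) (l : F) :
    Prop :=
  forall c : rat, exists N : nat, forall n : nat,
    (N <= n)%N -> val_ge v c (u n - l).

Definition padic_val (p : nat) (q : rat) : rat :=
  (logn p `|numq q|)%:R - (logn p `|denq q|)%:R.

(* [(Q, v)] is the field of p-adic numbers, that is, the completion (unique up
   to a unique isomorphism) of the rationals for the p-adic valuation.  The
   condition [ratr q != 0] says that [ratr] embeds rat in [Q]. *)
Record is_Qp (p : nat) (Q : fieldType) (v : Q -> rat) : Prop := IsQp {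
  Qp_valuation : valuation v;
  Qp_rat : forall q : rat, q != 0 ->
    (ratr q : Q) != 0 /\ v (ratr q) = padic_val p q;
  Qp_dense : forall (x : Q) (c : rat), exists q : rat, val_ge v c (x - ratr q);
  Qp_complete : forall u : nat -> Q, val_cauchy v u -> exists l, val_cvg v u l
}.

(* [v] is the valuation of the p-adic field L, normalized by v(p) = 1; its
   restriction to K is then the valuation of K. *)
Definition extends_valuation (Q : fieldType) (vp : Q -> rat)
    (K : fieldExtType Q) (L : fieldExtType K) (v : L -> rat) : Prop :=
  valuation v /\ forall x : Q, x != 0 -> v (x%:A : K)%:A = vp x.

(* v(L^* ) = v(K^* ), i.e. the ramification index is 1.  Residue fields of
   p-adic fields being finite, no separability condition is needed. *)
Definition unramified (K : fieldType) (L : fieldExtType K) (v : L -> rat) :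
    Prop :=
  forall x : L, x != 0 -> exists2 a : K, a != 0 & v x = v a%:A.

(** * Tensor products of finite-dimensional vector spaces *)

(* The tensor product is realized on matrices through the reference bases:
   the matrix t stands for the sum of the t i j *: (e_i (x) e'_j). *)
Notation tens V W := 'M_(\dim {: V}, \dim {: W}).

Definition tensv (K : fieldType) (V W : vectType K) (x : V) (y : W) :
    'M[K]_(\dim {: V}, \dim {: W}) :=
  \matrix_(i, j) (coord (vbasis {: V}) i x * coord (vbasis {: W}) j y).

Definition bilinear2 (K : fieldType) (V W X : vectType K) (f : V -> W -> X) :
    Prop :=
  (forall y, linear (f ^~ y)) /\ (forall x, linear (f x)).

(* The linear map on the tensor product induced by a bilinear map [f].  If
   Delta is a comultiplication, [tlift f (Delta h)] is what Sweedler's notation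
   writes sum_(h) f(h_(1), h_(2)). *)
Definition tlift (K : fieldType) (V W X : vectType K) (f : V -> W -> X)
    (t : 'M[K]_(\dim {: V}, \dim {: W})) : X :=
  \sum_i \sum_j t i j *: f (vbasis {: V})`_i (vbasis {: W})`_j.

Lemma tensv_bilinear (K : fieldType) (V W : vectType K) :
  bilinear2 (@tensv K V W).
Proof.
split=> [y a x x'|x a y y']; apply/matrixP=> i j; rewrite !mxE linearP.
  by rewrite mulrDl mulrA.
by rewrite mulrDr mulrCA.
Qed.

Lemma tlift_linear (K : fieldType) (V W X : vectType K) (f : V -> W -> X) :
  linear (tlift f).
Proof.
move=> a s t; rewrite /tlift scaler_sumr -big_split; apply: eq_bigr => i _ /=.
rewrite scaler_sumr -big_split; apply: eq_bigr => j _ /=.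
by rewrite !mxE scalerDl scalerA.
Qed.

Lemma tlift_tensv (K : fieldType) (V W X : vectType K) (f : V -> W -> X) :
  bilinear2 f -> forall x y, tlift f (tensv x y) = f x y.
Proof.
move=> [fl fr] x y.
pose gl z := HB.pack (f ^~ z) (GRing.isLinear.Build _ _ _ _ _ (fl z)) :
  {linear V -> X}.
pose gr z := HB.pack (f z) (GRing.isLinear.Build _ _ _ _ _ (fr z)) :
  {linear W -> X}.
rewrite {2}(coord_vbasis (memvf x)) -[RHS]/(gl y _) linear_sum.
apply: eq_bigr => i _; rewrite linearZZ -[gl y _]/(gr _ y).
rewrite {2}(coord_vbasis (memvf y)) linear_sum scaler_sumr.
by apply: eq_bigr => j _; rewrite mxE linearZZ scalerA.
Qed.

Lemma tlift_unique (K : fieldType) (V W X : vectType K)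
    (g : {linear tens V W -> X}) (t : 'M[K]_(\dim {: V}, \dim {: W})) :
  g t = tlift (fun x y => g (tensv x y)) t.
Proof.
rewrite {1}[t]matrix_sum_delta linear_sum; apply: eq_bigr => i _.
rewrite linear_sum; apply: eq_bigr => j _; rewrite linearZ; congr (_ *: g _).
apply/matrixP=> k l; rewrite !mxE !coord_free ?(basis_free (vbasisP _)) //.
by rewrite -natrM mulnb ![_ == i]eq_sym ![_ == j]eq_sym.
Qed.

(** * Hopf algebras and Hopf-Galois structures *)

Record hopf_structure (K : fieldType) (H : falgType K) := HopfStructure {
  comul : {linear H -> tens H H};
  counit : {lrmorphism H -> K^o};
  antipode : {linear H -> H};
  comul_coassoc : forall h,
    tlift (fun a b => tlift (fun a1 a2 => tensv a1 (tensv a2 b)) (comul a))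
          (comul h) =
    tlift (fun a b => tensv a (comul b)) (comul h);
  comul_counitl : forall h, tlift (fun a b => (counit a : K) *: b) (comul h) = h;
  comul_counitr : forall h, tlift (fun a b => (counit b : K) *: a) (comul h) = h;
  comul1 : comul 1 = tensv 1 1;
  comulM : forall h k,
    comul (h * k) =
    tlift (fun h1 h2 => tlift (fun k1 k2 => tensv (h1 * k1) (h2 * k2)) (comul k))
          (comul h);
  antipodel : forall h,
    tlift (fun a b => antipode a * b) (comul h) = (counit h : K) *: 1;
  antipoder : forall h,
    tlift (fun a b => a * antipode b) (comul h) = (counit h : K) *: 1
}.

Definition module_algebra (K : fieldType) (H : falgType K)
    (hs : hopf_structure H) (L : fieldExtType K)
    (act : {linear H -> 'End(L)}) : Prop :=
  [/\ act 1 = \1%VF,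
      forall h k, act (h * k) = (act h \o act k)%VF,
      forall h s t,
        act h (s * t) = tlift (fun h1 h2 => act h1 s * act h2 t) (comul hs h) &
      forall h, act h 1 = (counit hs h : K)%:A].

Definition galois_map (K : fieldType) (H : falgType K) (L : fieldExtType K)
    (act : {linear H -> 'End(L)}) : tens L H -> 'End(L) :=
  tlift (fun (s : L) (h : H) => linfun (fun t : L => s * act h t)).

Definition hopf_galois (K : fieldType) (H : falgType K)
    (hs : hopf_structure H) (L : fieldExtType K)
    (act : {linear H -> 'End(L)}) : Prop :=
  module_algebra hs act /\ bijective (galois_map act).

(** * Associated orders and freeness *)

Definition associated_order (K : fieldType) (H : falgType K)
    (L : fieldExtType K) (act : {linear H -> 'End(L)}) (O : pred L) :
    H -> Prop :=
  fun h => forall x, O x -> O (act h x).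

(* The A-stable subset M of L has a finite basis over the subring A of H. *)
Definition free_module (K : fieldType) (H : falgType K)
    (L : fieldExtType K) (act : {linear H -> 'End(L)})
    (A : H -> Prop) (M : pred L) : Prop :=
  exists (n : nat) (b : 'I_n -> L),
    [/\ forall i, M (b i),
        forall x, M x -> exists a : 'I_n -> H,
          (forall i, A (a i)) /\ x = \sum_i act (a i) (b i) &
        forall a : 'I_n -> H, (forall i, A (a i)) ->
          \sum_i act (a i) (b i) = 0 -> forall i, a i = 0].

(* Main.v *)
From HB Require Import structures.
Require Import Defs.
From mathcomp Require Import all_boot all_order all_algebra all_field.
From mathcomp Require Import boolp ring.

(**
  Let w_i be an O_K-basis of O_L (it exists because L/K is unramified and Q_p is
  complete), t a uniformizer of K, k and l the residue fields, A the associated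
  order.  No Galois theory of L/K is used.

  Write the coordinate forms as E_j = sum_m w_m h_jm with h_jm in H.  The map
  Theta x = sum_(j,m) w_m (x) w_j (x) h_jm x from L to L (x) L (x) L is a ring
  homomorphism, because 1 (x) h = sum_(j,m) h(w_j) w_m (x) h_jm for all h.  Since
  k is finite, l (x) l (x) l is reduced, so Theta cannot have denominators on
  O_L: h_jm is in A.  Hence every O_K-endomorphism of O_L is of the form
  sum_i w_i h_i with h_i in A.  The trace form satisfies
  Tr(h x * y) = Tr(x * S(h) y), since H is cocommutative; rescaled, it is perfect
  on O_L, so A is stable under the antipode and, taking adjoints, every
  O_K-endomorphism of O_L is also of the form x |-> sum_i h_i (w_i x).

  Modulo t, with B the reduction of A, this says that End_k(l), which is l^n as a
  B-module, is free over B with basis the multiplications by the w_i.  So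
  #Hom_B(l, Y)^n = #Y^n for every B-submodule Y of l, and Moebius inversion over
  the submodules turns the existence of an automorphism of l into the existence
  of a generator of l.  Any lift of this generator is a basis of O_L over A.
*)

Set Implicit Arguments.
Unset Strict Implicit.
Unset Printing Implicit Defensive.

Import Order.TTheory GRing.Theory Num.Theory.
Local Open Scope ring_scope.

(** * Valuations *)

(** For [c = 0] this is the maximal ideal of the valuation ring; as in [val_ge], the element 0 is
    included. *)
Definition val_gt (F : fieldType) (v : F -> rat) (c : rat) : pred F :=
  fun x => (x == 0) || (c < v x).

Section Valuation.
Variables (F : fieldType) (v : F -> rat).
Hypothesis hv : valuation v.

Lemma valuationM x y : x != 0 -> y != 0 -> v (x * y) = v x + v y.
Proof. exact: hv.1. Qed.

Lemma valuation1 : v 1 = 0.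
Proof.
by apply: (addrI (v 1)); rewrite -valuationM ?oner_neq0 // mulr1 addr0.
Qed.

Lemma valuationN x : v (- x) = v x.
Proof.
have [-> | x0] := eqVneq x 0; first by rewrite oppr0.
have vN1 : v (-1) = 0.
  have : v (-1) + v (-1) = 0.
    by rewrite -valuationM ?oppr_eq0 ?oner_neq0 // mulrNN mulr1 valuation1.
  by move/eqP; rewrite -mulr2n mulrn_eq0 /= => /eqP.
by rewrite -mulN1r valuationM ?oppr_eq0 ?oner_neq0 // vN1 add0r.
Qed.

Lemma valuationV x : x != 0 -> v x^-1 = - v x.
Proof.
move=> x0; apply: (addrI (v x)).
by rewrite -valuationM ?invr_neq0 // mulfV // valuation1 subrr.
Qed.

Lemma valuationX x n : x != 0 -> v (x ^+ n) = v x *+ n.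
Proof.
move=> x0; elim: n => [|n IHn]; first by rewrite expr0 valuation1.
by rewrite exprS valuationM ?expf_neq0 // IHn mulrS.
Qed.

Lemma val_ge0 c : val_ge v c 0.
Proof. by rewrite /val_ge eqxx. Qed.

Lemma val_gt0 c : val_gt v c 0.
Proof. by rewrite /val_gt eqxx. Qed.

Lemma val_geE c x : x != 0 -> val_ge v c x = (c <= v x).
Proof. by rewrite /val_ge => /negPf->. Qed.

Lemma val_gtE c x : x != 0 -> val_gt v c x = (c < v x).
Proof. by rewrite /val_gt => /negPf->. Qed.

Lemma val_ge1 : val_ge v 0 1.
Proof. by rewrite val_geE ?oner_neq0 // valuation1. Qed.

Lemma val_gt_ge c x : val_gt v c x -> val_ge v c x.
Proof. by case/orP => [/eqP->|/ltW h]; rewrite ?val_ge0 // /val_ge h orbT. Qed.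

Lemma val_ge_gt c d x : val_ge v d x -> c < d -> val_gt v c x.
Proof.
move=> /orP[/eqP->|h] cd; rewrite ?val_gt0 // /val_gt.
by rewrite (lt_le_trans cd h) orbT.
Qed.

Lemma val_geW c d x : val_ge v d x -> c <= d -> val_ge v c x.
Proof.
move=> /orP[/eqP->|h] cd; rewrite ?val_ge0 // /val_ge.
by rewrite (le_trans cd h) orbT.
Qed.

Lemma val_geN c x : val_ge v c (- x) = val_ge v c x.
Proof. by rewrite /val_ge oppr_eq0 valuationN. Qed.

Lemma val_gtN c x : val_gt v c (- x) = val_gt v c x.
Proof. by rewrite /val_gt oppr_eq0 valuationN. Qed.

Lemma val_geD c x y : val_ge v c x -> val_ge v c y -> val_ge v c (x + y).
Proof.
have [-> | x0] := eqVneq x 0; first by rewrite add0r.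
have [-> | y0] := eqVneq y 0; first by rewrite addr0.
have [-> | s0] := eqVneq (x + y) 0; first by rewrite val_ge0.
rewrite !val_geE // => cx cy; apply: le_trans (hv.2 _ _ x0 y0 s0).
by rewrite le_min cx.
Qed.

Lemma val_gtD c x y : val_gt v c x -> val_gt v c y -> val_gt v c (x + y).
Proof.
have [-> | x0] := eqVneq x 0; first by rewrite add0r.
have [-> | y0] := eqVneq y 0; first by rewrite addr0.
have [-> | s0] := eqVneq (x + y) 0; first by rewrite val_gt0.
rewrite !val_gtE // => cx cy; apply: lt_le_trans (hv.2 _ _ x0 y0 s0).
by rewrite lt_min cx.
Qed.

Lemma val_geB c x y : val_ge v c x -> val_ge v c y -> val_ge v c (x - y).
Proof. by move=> hx hy; apply: val_geD; rewrite ?val_geN. Qed.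

Lemma val_gtB c x y : val_gt v c x -> val_gt v c y -> val_gt v c (x - y).
Proof. by move=> hx hy; apply: val_gtD; rewrite ?val_gtN. Qed.

Lemma val_geM c d x y : val_ge v c x -> val_ge v d y -> val_ge v (c + d) (x * y).
Proof.
have [-> | x0] := eqVneq x 0; first by rewrite mul0r !val_ge0.
have [-> | y0] := eqVneq y 0; first by rewrite mulr0 !val_ge0.
by rewrite !val_geE ?mulf_neq0 // valuationM //; apply: lerD.
Qed.

Lemma val_gtM x y : val_ge v 0 x -> val_gt v 0 y -> val_gt v 0 (x * y).
Proof.
have [-> | x0] := eqVneq x 0; first by rewrite mul0r !val_gt0 ?val_ge0.
have [-> | y0] := eqVneq y 0; first by rewrite mulr0 !val_gt0.
by rewrite val_geE // !val_gtE ?mulf_neq0 // valuationM //; apply: ltr_wpDl.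
Qed.

Lemma val_ge0M x y : val_ge v 0 x -> val_ge v 0 y -> val_ge v 0 (x * y).
Proof. by move=> hx hy; rewrite -[0]addr0 val_geM. Qed.

Lemma val_ge0X x n : val_ge v 0 x -> val_ge v 0 (x ^+ n).
Proof.
move=> hx; elim: n => [|n IHn]; first by rewrite expr0 val_ge1.
by rewrite exprS val_ge0M.
Qed.

Lemma val_ge_sum (I : finType) (P : pred I) c (f : I -> F) :
  (forall i, P i -> val_ge v c (f i)) -> val_ge v c (\sum_(i | P i) f i).
Proof.
by move=> h; elim/big_ind: _ => //; [exact: val_ge0 | exact: val_geD].
Qed.

Lemma val_gt_sum (I : finType) (P : pred I) c (f : I -> F) :
  (forall i, P i -> val_gt v c (f i)) -> val_gt v c (\sum_(i | P i) f i).
Proof.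
by move=> h; elim/big_ind: _ => //; [exact: val_gt0 | exact: val_gtD].
Qed.

Lemma val_ge_all_eq0 x : (forall c, val_ge v c x) -> x = 0.
Proof.
move=> h; apply/eqP; apply/negPn/negP => x0.
by move: (h (v x + 1)); rewrite val_geE // leNgt ltrDl ltr01.
Qed.

(** The ultrametric inequality is applied to x = (x - y) + y and to y = x - (x - y). *)
Lemma val_close x y : x != 0 -> val_gt v (v x) (x - y) -> y != 0 /\ v y = v x.
Proof.
move=> x0 hxy; have y0 : y != 0.
  by apply: contraL hxy => /eqP->; rewrite subr0 val_gtE // ltxx.
split=> //; apply/eqP; rewrite eq_le; apply/andP; split.
  rewrite leNgt; apply/negP => lt.
  have : val_gt v (v x) (x - y + y) by rewrite val_gtD // val_gtE.
  by rewrite subrK val_gtE // ltxx.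
have : val_ge v (v x) (x - (x - y)).
  by apply: val_geB; [rewrite val_geE | apply: val_gt_ge].
by rewrite subKr val_geE.
Qed.

Lemma valuation_unit x : val_ge v 0 x -> ~~ val_gt v 0 x -> x != 0 /\ v x = 0.
Proof.
move=> h; have [-> | x0] := eqVneq x 0; first by rewrite val_gt0.
rewrite val_gtE // -leNgt => h2; split => //; apply/eqP.
by rewrite eq_le h2 -val_geE.
Qed.

(** [c j] is a nonzero entry of least valuation. Dividing by it makes the family integral with
    [j]-th entry 1, so that a linear relation can be reduced modulo the maximal ideal and stays
    nontrivial. *)
Lemma val_normalize (I : finType) (c : I -> F) i0 : c i0 != 0 ->
  exists j, [/\ c j != 0, v (c j) <= v (c i0)
    & forall i, val_ge v 0 (c i / c j)].
Proof.
move=> ci0; pose j := [arg min_(i < i0 | c i != 0) v (c i)]%O.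
have [cj0 jmin] : c j != 0 /\ (forall i, c i != 0 -> v (c j) <= v (c i)).
  by rewrite /j; case: arg_minP.
exists j; split=> [||i] //; first exact: jmin.
have [-> | ci] := eqVneq (c i) 0; first by rewrite mul0r !val_ge0.
rewrite val_geE ?mulf_neq0 ?invr_neq0 // valuationM ?invr_neq0 // valuationV //.
by rewrite subr_ge0 jmin.
Qed.

End Valuation.

Lemma rat_lt_nat (x : rat) : exists N : nat, x < N%:R.
Proof.
by exists (Num.truncn `|x|).+1; apply: le_lt_trans (ler_norm _) (truncnS_gt _).
Qed.

Lemma rat_le_nat (x : rat) : exists N : nat, x <= N%:R.
Proof. by have [N /ltW] := rat_lt_nat x; exists N. Qed.

(** * Coordinates over a complete field are controlled by the valuation *)

Section BoundedCoordinates.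
Variables (Q : fieldType) (vp : Q -> rat) (E : fieldExtType Q) (v : E -> rat).
Hypotheses (hvp : valuation vp) (hv : valuation v).
Hypothesis vE : forall a : Q, a != 0 -> v (a%:A) = vp a.
Hypothesis complete : forall u, val_cauchy vp u -> exists l, val_cvg vp u l.

Lemma val_ge_alg c a : val_ge v c (a%:A) = val_ge vp c a.
Proof.
have [-> | a0] := eqVneq a 0; first by rewrite scale0r !val_ge0.
by rewrite !val_geE ?vE // scaler_eq0 oner_eq0 orbF.
Qed.

Lemma val_gt_alg c a : val_gt v c (a%:A) = val_gt vp c a.
Proof.
have [-> | a0] := eqVneq a 0; first by rewrite scale0r !val_gt0.
by rewrite !val_gtE ?vE // scaler_eq0 oner_eq0 orbF.
Qed.

Lemma val_geZ c d a x : val_ge vp c a -> val_ge v d x -> val_ge v (c + d) (a *: x).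
Proof. by move=> ha hx; rewrite -mulr_algl val_geM // val_ge_alg. Qed.

Lemma rat_common_bound (I : finType) (f : I -> rat) : exists C, forall i, f i <= C.
Proof.
exists (\sum_i `|f i|) => i; rewrite (bigD1 i) //=.
by apply: le_trans (ler_norm _) _; rewrite lerDl sumr_ge0.
Qed.

(** Comparison of norms on a finite-dimensional space over a complete field: up to the constant [C],
    a small combination has small coefficients. Coefficients are indexed by [nat], so passing to the
    tail of [X] needs no casts. *)
Lemma bounded_coords (X : seq E) : free X ->
  exists C : rat, forall (c : nat -> Q) r,
    val_ge v r (\sum_(i < size X) c i *: X`_i) ->
    forall i, (i < size X)%N -> val_ge vp (r - C) (c i).
Proof.
elim: X => [|e X IH]; first by exists 0.
rewrite free_cons => /andP[eX fX]; have {}IH := IH fX; case: IH => C0 hC0.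
(* The span of X is complete, hence closed, so e is at positive distance. *)
have [C1 hC1] : exists C1 : rat, forall c : nat -> Q,
    ~~ val_gt v C1 (e + \sum_(i < size X) c i *: X`_i).
  apply/not_existsP => hno.
  have {hno} app (m : nat) : exists c : nat -> Q,
      val_ge v m%:R (e + \sum_(i < size X) c i *: X`_i).
    have /existsNP[c /negP] := hno m%:R; rewrite negbK => hc.
    by exists c; apply: val_gt_ge.
  have [u hu] := choice app.
  have ucauchy i : (i < size X)%N -> val_cauchy vp (fun m => u m i).
    move=> iX c; have [N hN] := rat_le_nat (c + C0).
    exists N => m n Nm Nn.
    have -> : c = c + C0 - C0 by rewrite addrK.
    apply: (hC0 (fun i => u m i - u n i)) => //.
    under eq_bigr do rewrite scalerBl.
    have shift (a b : E) : a - b = (e + a) - (e + b).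
      by rewrite opprD addrACA subrr add0r.
    rewrite sumrB shift.
    apply: (val_geB hv).
      by apply: val_geW (hu m) _; apply: le_trans hN _; rewrite ler_nat.
    by apply: val_geW (hu n) _; apply: le_trans hN _; rewrite ler_nat.
  have lim i : exists l, (i < size X)%N -> val_cvg vp (fun m => u m i) l.
    case: (ltnP i (size X)) => [iX|_]; last by exists 0.
    by have [l hl] := complete (ucauchy _ iX); exists l.
  have [l hl] := choice lim.
  move/negP: eX; apply.
  (* The coefficientwise limits put [e] in the span of [X]: the difference of the two sides has
     arbitrarily large valuation. *)
  suff -> : e = - \sum_(i < size X) l i *: X`_i.
    rewrite memvN memv_suml // => i _; apply/memvZ/memv_span/mem_nth/ltn_ord.
  apply/eqP; rewrite -addr_eq0; apply/eqP; apply: (val_ge_all_eq0 (v := v)) => c.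
  have [N hN] := rat_le_nat c.
  have [D hD] : exists D, forall i : 'I_(size X), - v X`_i <= D by apply: rat_common_bound.
  have /choice[M hM] : forall i : 'I_(size X), exists M : nat, forall n, (M <= n)%N ->
      val_ge vp (c + D) (u n i - l i).
    by move=> i; apply: hl.
  pose n := (N + \max_i M i)%N.
  have -> : e + \sum_(i < size X) l i *: X`_i =
    e + \sum_(i < size X) u n i *: X`_i - \sum_(i < size X) (u n i - l i) *: X`_i.
    rewrite -addrA -sumrB; congr (_ + _); apply: eq_bigr => i _.
    by rewrite -scalerBl subKr.
  apply: (val_geB hv).
    by apply: val_geW (hu n) _; apply: le_trans hN _; rewrite ler_nat leq_addr.
  apply: (val_ge_sum hv) => i _.
  have /(val_geZ (d := - D)) : val_ge vp (c + D) (u n i - l i).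
    by apply: hM; apply: leq_trans (leq_addl _ _); apply: leq_bigmax.
  rewrite addrK; apply; apply/orP; right.
  by rewrite lerNl.
have [D hD] : exists D, forall i : 'I_1, - v e <= D by apply: rat_common_bound.
have {hD} hD := hD ord0.
(* The coefficient of [e] costs [C1]. For the others, removing [c 0 *: e] costs [C1 + D], as
   [- v e <= D], and the induction hypothesis costs [C0]. *)
pose C2 := Num.max C1 (C0 + (C1 + D)).
have hC1' (c : nat -> Q) r :
    val_ge v r (\sum_(i < size (e :: X)) c i *: (e :: X)`_i) ->
    val_ge vp (r - C1) (c 0%N).
  rewrite /= big_ord_recl /=; have [-> | c0] := eqVneq (c 0%N) 0.
    by rewrite val_ge0.
  move=> hr; rewrite val_geE //; set x := (X in val_ge v r X) in hr.
  rewrite lerBlDr leNgt; apply/negP => lt.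
  have /negP := hC1 (fun i => (c 0%N)^-1 * c i.+1); apply.
  have -> : e + \sum_(i < size X) ((c 0%N)^-1 * c i.+1) *: X`_i = (c 0%N)^-1 *: x.
    rewrite /x scalerDr scalerA mulVf // scale1r scaler_sumr; congr (_ + _).
    by apply: eq_bigr => i _; rewrite scalerA.
  have : val_ge v (- vp (c 0%N) + r) ((c 0%N)^-1 *: x).
    by apply: val_geZ => //; rewrite val_geE ?invr_eq0 // (valuationV hvp).
  by move/val_ge_gt; apply; rewrite addrC ltrBrDr addrC.
exists C2 => c r hr [|i] iX.
  by apply: val_geW (hC1' _ _ hr) _; rewrite lerB // le_max lexx.
have hc0 := hC1' _ _ hr.
apply: (@val_geW _ _ _ (r - (C1 + D) - C0)); last first.
  by rewrite -addrA -opprD lerD2l lerN2 /C2 le_max [C0 + _]addrC lexx orbT.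
apply: (hC0 (fun i => c i.+1)) => //.
have -> : \sum_(i0 < size X) c i0.+1 *: X`_i0 =
   \sum_(i < size (e :: X)) c i *: (e :: X)`_i - c 0%N *: e.
  by rewrite /= big_ord_recl /= addrC addKr.
apply: (val_geB hv).
  apply: val_geW hr _; rewrite lerBlDr lerDl.
  (* Zero coefficients in [hC1] give [v e <= C1], whence [0 <= C1 + D]. *)
  have : ~~ val_gt v C1 (e + \sum_(i < size X) 0 *: X`_i) by exact: (hC1 (fun _ => 0)).
  rewrite big1 => [|i0 _]; last by rewrite scale0r.
  rewrite addr0 /val_gt negb_or -leNgt => /andP[_ le].
  by rewrite -(subrr (v e)) lerD.
rewrite opprD addrA; apply: val_geZ => //; apply/orP; right.
by rewrite lerNl.
Qed.

End BoundedCoordinates.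

(** * Residue fields *)

Section ResidueField.
Variables (F : fieldType) (v : F -> rat).
Hypothesis hv : valuation v.
Variable S : seq F.
Hypothesis hS : forall x, val_ge v 0 x -> exists2 s, s \in S & val_gt v 0 (x - s).

(** Residue classes are represented by canonical elements: the first member of [S] congruent to [x].
    Congruent elements filter [S] identically, hence get the same representative. *)
Definition residue_rep (x : F) : F :=
  head 0 [seq s <- S | val_gt v 0 (x - s)].

Lemma residue_rep_close x : val_ge v 0 x -> val_gt v 0 (x - residue_rep x).
Proof.
move=> /hS[s sS xs]; rewrite /residue_rep.
have : s \in [seq s <- S | val_gt v 0 (x - s)] by rewrite mem_filter xs.
case E : [seq _ <- _ | _] => [|t l] // _ /=.
have : t \in [seq s <- S | val_gt v 0 (x - s)] by rewrite E mem_head.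
by rewrite mem_filter => /andP[].
Qed.

Lemma residue_rep_ge x : val_ge v 0 x -> val_ge v 0 (residue_rep x).
Proof.
move=> xO; rewrite -[residue_rep x](subKr x).
by apply: val_geB => //; apply/val_gt_ge/residue_rep_close.
Qed.

Lemma residue_rep_eq x y :
  val_gt v 0 (x - y) -> residue_rep x = residue_rep y.
Proof.
move=> xy; congr (head 0 _); apply: eq_filter => s; apply/idP/idP => h.
  by rewrite -(subrKA x) val_gtD // -val_gtN // opprB.
by rewrite -(subrKA y) val_gtD.
Qed.

Definition residue_seq : seq F :=
  [seq residue_rep s | s <- S & val_ge v 0 s].

(* The proofs are parameters so that the ring structures are canonical. *)
Definition residue_ring_type of valuation v &
  (forall x, val_ge v 0 x -> exists2 s, s \in S & val_gt v 0 (x - s)) :=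
  seq_sub residue_seq.
Local Notation residue_type := (residue_ring_type hv hS).

HB.instance Definition _ := Finite.on residue_type.

Lemma residue_rep_mem x : val_ge v 0 x -> residue_rep x \in residue_seq.
Proof.
move=> xO; have [s sS xs] := hS xO; apply/mapP; exists s.
  rewrite mem_filter sS andbT -[s](subKr x).
  by apply: val_geB => //; apply: val_gt_ge.
exact: residue_rep_eq.
Qed.

(** A total function, meaningful on integral elements only; [insubd] falls back on the class of
    0. *)
Definition residue_map (x : F) : residue_type :=
  insubd (SeqSub (residue_rep_mem (val_ge0 v 0))) (residue_rep x).

Lemma residue_mapK x : val_ge v 0 x -> val (residue_map x) = residue_rep x.
Proof. by move=> xO; rewrite insubdK //; apply: residue_rep_mem. Qed.

Lemma residue_ge (a : residue_type) : val_ge v 0 (val a).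
Proof.
case: a => a /= /mapP[s]; rewrite mem_filter => /andP[sO _] ->.
exact: residue_rep_ge.
Qed.

Lemma residue_valK (a : residue_type) : residue_map (val a) = a.
Proof.
apply: val_inj; rewrite residue_mapK ?residue_ge //.
case: a => a /= /mapP[s]; rewrite mem_filter => /andP[sO _] ->.
by apply: residue_rep_eq; rewrite -val_gtN // opprB residue_rep_close.
Qed.

Lemma residue_map_eq x y : val_ge v 0 x -> val_ge v 0 y ->
  (residue_map x = residue_map y) <-> val_gt v 0 (x - y).
Proof.
move=> xO yO; split=> [/(congr1 val)|xy].
  rewrite !residue_mapK // => e; rewrite -(subrKA (residue_rep x)).
  apply: val_gtD => //; first exact: residue_rep_close.
  by rewrite e -val_gtN // opprB residue_rep_close.
by apply: val_inj; rewrite !residue_mapK //; apply: residue_rep_eq.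
Qed.

Lemma residue_map_val x : val_ge v 0 x -> val_gt v 0 (x - val (residue_map x)).
Proof. by move=> xO; rewrite residue_mapK ?residue_rep_close. Qed.

Let O1 := val_ge1 hv.
Let res_add (a b : residue_type) := residue_map (val a + val b).
Let res_mul (a b : residue_type) := residue_map (val a * val b).
Let res_opp (a : residue_type) := residue_map (- val a).

Lemma residue_mapD x y : val_ge v 0 x -> val_ge v 0 y ->
  residue_map (x + y) = res_add (residue_map x) (residue_map y).
Proof.
move=> xO yO; apply/residue_map_eq; rewrite ?val_geD ?residue_ge //.
by rewrite opprD addrACA val_gtD ?residue_map_val.
Qed.

Lemma residue_mapM x y : val_ge v 0 x -> val_ge v 0 y ->
  residue_map (x * y) = res_mul (residue_map x) (residue_map y).
Proof.
move=> xO yO; apply/residue_map_eq; rewrite ?val_ge0M ?residue_ge //.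
set x' := val _; set y' := val _.
have -> : x * y - x' * y' = x * (y - y') + y' * (x - x').
  by rewrite !mulrBr [y' * x]mulrC [y' * x']mulrC addrA subrK.
by apply: val_gtD => //; apply: val_gtM => //; rewrite ?residue_map_val ?residue_ge.
Qed.

Fact res_addA : associative res_add.
Proof.
move=> a b c; rewrite -(residue_valK a) -(residue_valK b) -(residue_valK c).
by rewrite -!residue_mapD ?val_geD ?residue_ge // addrA.
Qed.
Fact res_addC : commutative res_add.
Proof. by move=> a b; rewrite /res_add addrC. Qed.
Fact res_add0 : left_id (residue_map 0) res_add.
Proof.
move=> a; rewrite -{1}(residue_valK a) -residue_mapD ?val_ge0 ?residue_ge //.
by rewrite add0r residue_valK.
Qed.
Fact res_addN : left_inverse (residue_map 0) res_opp res_add.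
Proof.
move=> a; rewrite -{2}(residue_valK a) -residue_mapD ?val_geN ?residue_ge //.
by rewrite addNr.
Qed.
HB.instance Definition _ :=
  GRing.isZmodule.Build residue_type res_addA res_addC res_add0 res_addN.

Fact res_mulA : associative res_mul.
Proof.
move=> a b c; rewrite -(residue_valK a) -(residue_valK b) -(residue_valK c).
by rewrite -!residue_mapM ?val_ge0M ?residue_ge // mulrA.
Qed.
Fact res_mulC : commutative res_mul.
Proof. by move=> a b; rewrite /res_mul mulrC. Qed.
Fact res_mul1 : left_id (residue_map 1) res_mul.
Proof.
move=> a; rewrite -{1}(residue_valK a) -residue_mapM ?residue_ge //.
by rewrite mul1r residue_valK.
Qed.
Fact res_mulD : left_distributive res_mul res_add.
Proof.
move=> a b c; rewrite -(residue_valK a) -(residue_valK b) -(residue_valK c).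
by rewrite -?(residue_mapM, residue_mapD) ?val_ge0M ?val_geD ?residue_ge // mulrDl.
Qed.
Fact res_1neq0 : residue_map 1 != residue_map 0.
Proof.
apply/eqP => /residue_map_eq; rewrite val_ge0 subr0 => /(_ O1 isT).
by rewrite val_gtE ?oner_neq0 // valuation1 // ltxx.
Qed.
HB.instance Definition _ :=
  GRing.Zmodule_isComNzRing.Build residue_type
    res_mulA res_mulC res_mul1 res_mulD res_1neq0.

Definition residue_inv (a : residue_type) : residue_type :=
  if a == 0 then 0 else residue_map (val a)^-1.

Fact residue_mulV (a : residue_type) : a != 0 -> residue_inv a * a = 1.
Proof.
move=> a0; rewrite /residue_inv (negPf a0).
have [x0 vx] : val a != 0 /\ v (val a) = 0.
  apply: valuation_unit; first exact: residue_ge.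
  apply: contra a0 => h; rewrite -(residue_valK a); apply/eqP/residue_map_eq.
  - exact: residue_ge.
  - exact: val_ge0.
  - by rewrite subr0.
rewrite -[X in _ * X](residue_valK a) -[LHS]residue_mapM ?residue_ge ?mulVf //.
by rewrite val_geE ?invr_neq0 // valuationV // vx oppr0.
Qed.
Fact residue_inv0 : residue_inv 0 = 0.
Proof. by rewrite /residue_inv eqxx. Qed.
HB.instance Definition _ :=
  GRing.ComNzRing_isField.Build residue_type residue_mulV residue_inv0.

End ResidueField.

(** The interface through which residue fields are used from here on: reduction is a total function
    on [F], constrained on integral elements only. *)
Record residue_morphism (F : fieldType) (v : F -> rat) (k : finFieldType)
    (r : F -> k) : Prop := ResidueMorphism {
  res1 : r 1 = 1;
  resD : forall x y, val_ge v 0 x -> val_ge v 0 y -> r (x + y) = r x + r y;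
  resM : forall x y, val_ge v 0 x -> val_ge v 0 y -> r (x * y) = r x * r y;
  res_eq0 : forall x, val_ge v 0 x -> (r x == 0) = val_gt v 0 x;
  res_onto : forall a, exists2 x, val_ge v 0 x & r x = a
}.

Lemma residue_field (F : fieldType) (v : F -> rat) (S : seq F) :
  valuation v ->
  (forall x, val_ge v 0 x -> exists2 s, s \in S & val_gt v 0 (x - s)) ->
  exists (k : finFieldType) (r : F -> k), residue_morphism v r.
Proof.
move=> hv hS.
exists (residue_ring_type hv hS), (residue_map hv hS).
split=> [//|x y|x y|x xO|a].
- exact: residue_mapD.
- exact: residue_mapM.
- rewrite -[x in RHS]subr0; apply/eqP/idP.
    by move/residue_map_eq => ->; rewrite ?val_ge0.
  by move=> h; apply/residue_map_eq; rewrite ?val_ge0.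
- by exists (val a); [exact: residue_ge | exact: residue_valK].
Qed.

(** * Reduction of sums, powers and integers *)

Section Reductions.
Variables (F : fieldType) (v : F -> rat) (k : finFieldType) (r : F -> k).
Hypotheses (hv : valuation v) (hr : residue_morphism v r).

Lemma res0 : r 0 = 0.
Proof. by apply/eqP; rewrite (res_eq0 hr) ?val_ge0 ?val_gt0. Qed.

Lemma res_sum (I : finType) (P : pred I) (f : I -> F) :
  (forall i, P i -> val_ge v 0 (f i)) ->
  r (\sum_(i | P i) f i) = \sum_(i | P i) r (f i).
Proof.
move=> hf; pose Q (x : F) (y : k) := val_ge v 0 x /\ r x = y.
suff [] : Q (\sum_(i | P i) f i) (\sum_(i | P i) r (f i)) by [].
apply: (big_ind2 Q) => [|x a y b [xO <-] [yO <-]|i Pi].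
- by split; [exact: val_ge0 | exact: res0].
- by split; [exact: val_geD | rewrite (resD hr)].
- by split; [exact: hf |].
Qed.

Lemma resN x : val_ge v 0 x -> r (- x) = - r x.
Proof.
move=> xO; apply/eqP; rewrite -addr_eq0 -(resD hr) ?val_geN //.
by rewrite addNr res0.
Qed.

Lemma resB x y : val_ge v 0 x -> val_ge v 0 y -> r (x - y) = r x - r y.
Proof. by move=> xO yO; rewrite (resD hr) ?val_geN // resN. Qed.

Lemma res_eq x y : val_ge v 0 x -> val_ge v 0 y ->
  (r x == r y) = val_gt v 0 (x - y).
Proof. by move=> xO yO; rewrite -subr_eq0 -resB // (res_eq0 hr) // val_geB. Qed.

Lemma resX x n : val_ge v 0 x -> r (x ^+ n) = r x ^+ n.
Proof.
move=> xO; elim: n => [|n IHn]; first by rewrite !expr0 (res1 hr).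
by rewrite !exprS (resM hr) ?val_ge0X // IHn.
Qed.

Lemma res_nat n : val_ge v 0 n%:R /\ r n%:R = n%:R.
Proof.
elim: n => [|n [nO IHn]]; first by rewrite val_ge0 res0.
by rewrite -natr1 val_geD ?val_ge1 // (resD hr) ?val_ge1 // (res1 hr) IHn natr1.
Qed.

End Reductions.

(** * Finite extensions of the p-adic numbers *)

Section PadicNumbers.
Variables (p : nat) (Q : fieldType) (vp : Q -> rat).
Hypotheses (p_prime : prime p) (hQ : is_Qp p vp).
Let hvp := Qp_valuation hQ.

Lemma Qp_int (z : int) : z != 0 ->
  (z%:~R : Q) != 0 /\ vp z%:~R = (logn p `|z|)%:R.
Proof.
move=> z0; have q0 : (z%:~R : rat) != 0 by rewrite intr_eq0.
have [] := Qp_rat hQ q0; rewrite ratr_int => -> ->; split=> //.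
by rewrite /padic_val numq_int denq_int logn1 subr0.
Qed.

Lemma Qp_int_ge (z : int) (D : nat) : (p ^ D %| `|z|)%N -> val_ge vp D%:R z%:~R.
Proof.
move=> dv; have [-> | z0] := eqVneq z 0; first by rewrite val_ge0.
have [nz vz] := Qp_int z0; rewrite val_geE // vz ler_nat.
by rewrite -pfactor_dvdn // absz_gt0.
Qed.

Lemma Qp_p : (p%:R : Q) != 0 /\ vp p%:R = 1.
Proof.
have [] := @Qp_int p; first by rewrite -lt0n prime_gt0.
by rewrite /= logn_prime // eqxx.
Qed.

Lemma Qp_natr_neq0 n : ((n.+1)%:R : Q) != 0.
Proof. by have [] := @Qp_int n.+1. Qed.

(** Density gives a rational [q] close to [c]. Being integral, it has a denominator prime to [p],
    and the Bezout coefficient [w] inverts that denominator modulo [p ^ D]; so [w * numq q], reduced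
    modulo [p ^ D], approximates [q]. *)
Lemma Zp_approx (c : Q) (D : nat) : val_ge vp 0 c ->
  exists2 a : 'I_(p ^ D), true & val_ge vp D%:R (c - a%:R).
Proof.
move=> cO; have pD0 : (0 < p ^ D)%N by rewrite expn_gt0 prime_gt0.
have [q hq] := Qp_dense hQ c D%:R.
have [q0 | q0] := eqVneq q 0.
  by exists (Ordinal pD0); rewrite //= subr0; move: hq; rewrite q0 -[0%R]/(0%:~R) ratr_int subr0.
have [rq0 vq] := Qp_rat hQ q0.
have qO : val_ge vp 0 (ratr q).
  rewrite -[ratr q](subKr c); apply: (val_geB hvp) => //.
  by apply: val_geW hq _; rewrite ler0n.
have pden : ~~ (p %| `|denq q|)%N.
  apply/negP => pd; move: qO; rewrite val_geE // vq subr_ge0 ler_nat => le.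
  have : (0 < logn p `|numq q|)%N.
    apply: leq_trans le; rewrite logn_gt0 mem_primes p_prime pd andbT /=.
    by rewrite absz_gt0 denq_neq0.
  rewrite logn_gt0 mem_primes => /and3P[_ _ pn].
  have : (p %| gcdn `|numq q| `|denq q|)%N by rewrite dvdn_gcd pn.
  by rewrite (eqP (coprime_num_den q)) dvdn1 gtn_eqF // prime_gt1.
have cop : coprimez (p ^ D)%N%:Z (denq q).
  by rewrite coprimezE /= coprimeXl // prime_coprime.
have [[u w] /= uw] := coprimezP _ _ cop.
pose z := (w * numq q)%R; pose P : int := (p ^ D)%N%:Z.
have P0 : P != 0 by rewrite /P eqz_nat -lt0n.
pose a := `|(z %% P)%Z|%N.
have aE : a%:Z = (z %% P)%Z by rewrite /a gez0_abs // modz_ge0.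
have aP : (a < p ^ D)%N by rewrite -ltz_nat aE ltz_pmod.
exists (Ordinal aP) => //=.
have -> : c - a%:R = (c - ratr q) + (ratr q - a%:R) by rewrite addrA subrK.
apply: (val_geD hvp) => //.
have [d0 vd] := Qp_int (denq_neq0 q).
have -> : ratr q - a%:R = (numq q - a%:Z * denq q)%:~R / (denq q)%:~R :> Q.
  by rewrite /ratr rmorphB rmorphM /= mulrBl mulfK.
rewrite -[D%:R]addr0; apply: (val_geM hvp); last first.
  rewrite val_geE ?invr_eq0 // (valuationV hvp) // vd oppr_ge0 (_ : logn _ _ = 0%N) //.
  by apply/eqP; rewrite eqn0Ngt logn_gt0 mem_primes (negPf pden) !andbF.
apply: Qp_int_ge; rewrite -[(p ^ D)%N]/(`|P|%N) -dvdzE aE.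
have -> : (z %% P)%Z = z - (z %/ P)%Z * P by rewrite {2}(divz_eq z P) addrC addKr.
have -> : numq q - (z - (z %/ P)%Z * P) * denq q =
   numq q * (1 - w * denq q) + (z %/ P)%Z * denq q * P.
  rewrite /z; ring.
by rewrite -uw addrK rpredD // -?mulrA ?dvdz_mull // mulrA dvdz_mull.
Qed.

End PadicNumbers.

(** * Finiteness modulo p, uniformizer and residue field of a finite extension *)

Section FiniteExtension.
Variables (p : nat) (Q : fieldType) (vp : Q -> rat).
Hypotheses (p_prime : prime p) (hQ : is_Qp p vp).
Variables (K : fieldExtType Q) (v : K -> rat).
Hypotheses (hv : valuation v).
Hypothesis vE : forall a : Q, a != 0 -> v (a%:A) = vp a.
Let hvp := Qp_valuation hQ.

Lemma fext_p : (p%:R : K) != 0 /\ v p%:R = 1.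
Proof.
have [p0 vp1] := Qp_p p_prime hQ.
rewrite -(@rmorph_nat _ _ (in_alg K)) fmorph_eq0 p0; split => //.
by rewrite /= vE.
Qed.

(** Integral elements have coordinates with bounded denominators in a basis over the p-adic numbers,
    and each coordinate can be approximated by one of finitely many fractions. *)
Lemma finite_mod_p : exists S : seq K,
  forall x, val_ge v 0 x -> exists2 s, s \in S & val_ge v 1 (x - s).
Proof.
pose X := vbasis {:K}; pose d := size X.
have dE : d = \dim {:K} by rewrite /d size_tuple.
have [C hC] := bounded_coords hvp hv vE (Qp_complete hQ) (basis_free (vbasisP {:K})).
have [C' hC'] := rat_common_bound (fun i : 'I_d => - v X`_i).
have [N hN] := rat_le_nat C.
have [M hM] := rat_le_nat (1 + C').
have [p0 vp1] := Qp_p p_prime hQ.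
(* [N] bounds the denominators of the coordinates and [M] makes up for basis vectors of negative
   valuation: the error in each term has valuation at least D - N - C' = M - C', which is at least
   1. *)
pose D := (N + M)%N.
pose g (a : {ffun 'I_d -> 'I_(p ^ D)}) : K :=
  \sum_i ((a i)%:R / p%:R ^+ N) *: X`_i.
exists (codom g) => x xO.
pose c (i : nat) : Q := if insub i is Some j then coord X j x else 0.
have xE : x = \sum_(i < d) c i *: X`_i.
  rewrite {1}(coord_vbasis (memvf x)) -/X; move: dE; rewrite /d => dE.
  have := size_tuple X; rewrite -/d => sz.
  rewrite -(big_mkord xpredT (fun i => c i *: X`_i)) /d size_tuple big_mkord.
  apply: eq_bigr => i _; rewrite /c insubT //= => ?.
  by congr (coord _ _ _ *: _); apply: val_inj.
have cO i : (i < d)%N -> val_ge vp (- N%:R) (c i).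
  move=> id; apply: (@val_geW _ _ _ (0 - C)); last by rewrite sub0r lerN2.
  by apply: (hC c) => //; rewrite -xE.
have /choice[a ha] : forall i : 'I_d, exists a : 'I_(p ^ D),
    val_ge vp D%:R (c i * p%:R ^+ N - a%:R).
  move=> i; have [] := Zp_approx p_prime hQ D (c := c i * p%:R ^+ N).
    rewrite -(addNr N%:R); apply: (val_geM hvp); first exact: cO.
    by rewrite val_geE ?expf_neq0 // (valuationX hvp) // vp1.
  by move=> a _; exists a.
exists (g [ffun i => a i]); first exact: codom_f.
rewrite xE /g -sumrB; apply: (val_ge_sum hv) => i _.
rewrite ffunE -scalerBl.
have -> : c i - (a i)%:R / p%:R ^+ N = (c i * p%:R ^+ N - (a i)%:R) / p%:R ^+ N.
  by rewrite mulrBl mulfK // expf_neq0.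
apply: (@val_geW _ _ _ (D%:R - N%:R - C')); last first.
  by rewrite /D natrD [N%:R + _]addrC addrK lerBrDr.
apply: (val_geZ hv vE).
  apply: (val_geM hvp) => //.
  rewrite val_geE ?invr_eq0 ?expf_neq0 // (valuationV hvp) ?expf_neq0 //.
  by rewrite (valuationX hvp) // vp1.
by apply/orP; right; rewrite lerNl.
Qed.

(** [t] has least positive valuation among [p] and the representatives modulo [p]. An element of
    valuation strictly between 0 and 1 has the valuation of its representative, by [val_close]. *)
Lemma uniformizer : exists2 t : K, t != 0 /\ 0 < v t &
  forall x, val_gt v 0 x -> val_ge v (v t) x.
Proof.
have [S hS] := finite_mod_p; have [p0 vp1] := fext_p.
pose S' := [seq s <- p%:R :: S | (s != 0) && (0 < v s)].
pose f (i : 'I_(size S')) := v S'`_i.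
have S0 : (0 < size S')%N by rewrite /S' /= p0 vp1 ltr01.
pose i := [arg min_(i < Ordinal S0) f i]%O.
have imin j : f i <= f j by rewrite /i; case: arg_minP => // i0 _; apply.
have : S'`_i \in S' by rewrite mem_nth.
rewrite mem_filter => /andP[/andP[t0 vt] _]; exists S'`_i => // x xm.
have tmin s : s \in S' -> v S'`_i <= v s.
  rewrite -index_mem => sS; have := imin (Ordinal sS).
  by rewrite /f /= nth_index // -index_mem.
have [-> | x0] := eqVneq x 0; first by rewrite val_ge0.
have [x1 | x1] := leP 1 (v x).
  rewrite val_geE //; apply: le_trans x1; rewrite -vp1; apply: tmin.
  by rewrite mem_filter p0 vp1 ltr01 mem_head.
have [s sS xs] := hS x (val_gt_ge xm).
have [s0 vs] := val_close hv x0 (val_ge_gt xs x1).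
rewrite val_geE // -vs; apply: tmin.
rewrite mem_filter inE sS orbT s0 vs andbT /=.
by move: xm; rewrite val_gtE.
Qed.

Lemma fext_residue_field :
  exists (k : finFieldType) (r : K -> k), residue_morphism v r.
Proof.
have [S hS] := finite_mod_p; apply: (residue_field (S := S)) => // x /hS[s sS xs].
by exists s => //; apply: val_ge_gt xs ltr01.
Qed.

End FiniteExtension.

(** * Integral bases *)

Section ResidualFreeness.
Variables (K : fieldType) (L : fieldExtType K) (v : L -> rat).
Hypothesis hv : valuation v.

Definition base_val (a : K) := v a%:A.
Local Notation vK := base_val.

Lemma base_valuation : valuation vK.
Proof.
split=> x y x0 y0; rewrite /vK.
  by rewrite -[(x * y)%:A]scalerA -mulr_algl
    (valuationM hv) // scaler_eq0 oner_eq0 orbF.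
by rewrite scalerDl => s0; apply: hv.2;
   rewrite -?scalerDl scaler_eq0 oner_eq0 orbF.
Qed.
Local Notation hvK := base_valuation.
Fact base_valE (a : K) : a != 0 -> v a%:A = vK a. Proof. by []. Qed.
Local Notation vKE := base_valE.

(** Integrality together with linear independence of the reductions over the residue field of [K],
    stated without naming residue fields. *)
Definition residually_free (X : seq L) :=
  (forall x, x \in X -> val_ge v 0 x) /\
  forall c : 'I_(size X) -> K, (forall i, val_ge vK 0 (c i)) ->
    val_gt v 0 (\sum_i c i *: X`_i) -> forall i, val_gt vK 0 (c i).

(** If a coefficient were not integral, division by one of least valuation would give a combination
    in the maximal ideal with integral coefficients, one of them equal to 1. *)
Lemma residually_free_coord X (c : 'I_(size X) -> K) : residually_free X ->
  val_ge v 0 (\sum_i c i *: X`_i) -> forall i, val_ge vK 0 (c i).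
Proof.
move=> [_ hX] hc i; apply/negPn/negP => ci.
have ci0 : c i != 0 by apply: contraNneq ci => ->; rewrite val_ge0.
have [j [cj0 cji cO]] := val_normalize hvK ci0.
have vcj : vK (c j) < 0.
  by apply: le_lt_trans cji _; rewrite ltNge -val_geE.
suff : val_gt vK 0 (c j / c j).
  by rewrite mulfV // val_gtE ?oner_eq0 // (valuation1 hvK) ltxx.
apply: (hX (fun i => c i / c j)) => //.
have -> : \sum_i0 (c i0 / c j) *: X`_i0 = (c j)^-1 *: (\sum_i c i *: X`_i).
  by rewrite scaler_sumr; apply: eq_bigr => a _; rewrite scalerA mulrC.
apply: (@val_ge_gt _ _ _ (- vK (c j) + 0)); last by rewrite addr0 oppr_gt0.
by apply: (val_geZ hv vKE) => //; rewrite val_geE ?invr_eq0 // (valuationV hvK).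
Qed.

Lemma residually_free_free X : residually_free X -> free X.
Proof.
move=> hX; apply/(@freeP _ _ _ (in_tuple X)) => c /= hc i.
apply: (val_ge_all_eq0 (v := vK)) => d.
have [-> | ci] := eqVneq (c i) 0; first exact: val_ge0.
have [j [cj0 _ cO]] := val_normalize hvK ci.
suff : val_gt vK 0 (c j / c j).
  by rewrite mulfV // val_gtE ?oner_eq0 // (valuation1 hvK) ltxx.
apply: (hX.2 (fun i => c i / c j)) => //.
have -> : \sum_i0 (c i0 / c j) *: X`_i0 = (c j)^-1 *: (\sum_i c i *: X`_i).
  by rewrite scaler_sumr; apply: eq_bigr => a _; rewrite scalerA mulrC.
by rewrite hc scaler0 val_gt0.
Qed.

(** In a relation modulo the maximal ideal, a unit coefficient of [x] could be divided out, making
    [x] congruent to a combination of [X]. *)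
Lemma residually_free_cons x X : residually_free X -> val_ge v 0 x ->
  (forall c : 'I_(size X) -> K, (forall i, val_ge vK 0 (c i)) ->
     ~~ val_gt v 0 (x - \sum_i c i *: X`_i)) ->
  residually_free (x :: X).
Proof.
move=> [XO hX] xO hx; split=> [y|c cO].
  by rewrite inE => /predU1P[->|/XO].
rewrite big_ord_recl /= => h.
have c0 : val_gt vK 0 (c ord0).
  apply/negPn/negP => nc0; have [c00 vc0] := valuation_unit (cO ord0) nc0.
  have ciO : val_ge vK 0 (c ord0)^-1.
    by rewrite val_geE ?invr_eq0 // (valuationV hvK) // vc0 oppr0.
  have /negP := hx (fun i => - ((c ord0)^-1 * c (lift ord0 i)))
    (fun i => etrans (val_geN hvK _ _) (val_ge0M hvK ciO (cO _))); apply.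
  have -> : x - \sum_i - ((c ord0)^-1 * c (lift ord0 i)) *: X`_i
     = (c ord0)^-1%:A * (c ord0 *: x + \sum_(i < size X) c (lift ord0 i) *: X`_i).
    rewrite mulr_algl scalerDr scalerA mulVf // scale1r scaler_sumr -sumrN.
    by congr (_ + _); apply: eq_bigr => i _; rewrite scaleNr opprK scalerA.
  by apply: (val_gtM hv) => //; rewrite (val_ge_alg vKE).
have h' : val_gt v 0 (\sum_(i < size X) c (lift ord0 i) *: X`_i).
  rewrite -[X in val_gt _ _ X](addKr (c ord0 *: x)) addrC.
  apply: (val_gtB hv) => //; rewrite -mulr_algl mulrC; apply: (val_gtM hv) => //.
  by rewrite (val_gt_alg vKE).
have hl := hX (fun i => c (lift ord0 i)) (fun i => cO _) h'.
by move=> i; case: (unliftP ord0 i) => [j ->|->].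
Qed.

(** Residually free families are free, so their sizes are bounded by the dimension. One of maximal
    size spans modulo the maximal ideal, since otherwise [residually_free_cons] would enlarge it. *)
Lemma residually_free_max : exists2 X, residually_free X &
  forall x, val_ge v 0 x -> exists2 c : 'I_(size X) -> K,
     (forall i, val_ge vK 0 (c i)) & val_gt v 0 (x - \sum_i c i *: X`_i).
Proof.
pose P n := `[< exists2 X, residually_free X & size X = n >].
have P0 : exists n, P n.
  by exists 0%N; apply/asboolP; exists [::] => //; split => // c _ _ [].
have Pmax n : P n -> (n <= \dim {:L})%N.
  move=> /asboolP[X /residually_free_free fX <-].
  by rewrite -(eqP fX : \dim <<X>> = size X) dimvS // subvf.
case: (ex_maxnP P0 Pmax) => n /asboolP[X hX sX] nmax; exists X => // x xO.
apply: contrapT => hno.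
have : P n.+1.
  apply/asboolP; exists (x :: X); last by rewrite /= sX.
  apply: residually_free_cons => // c cO; apply/negP => hc; apply: hno.
  by exists c.
by move/nmax; rewrite ltnn.
Qed.

End ResidualFreeness.

(** * Lifting a basis modulo the maximal ideal to an integral basis *)

Section IntegralBasis.
Variables (Q : fieldType) (vp : Q -> rat) (K : fieldExtType Q) (L : fieldExtType K).
Variable v : L -> rat.
Hypotheses (hvp : valuation vp) (hv : valuation v).
Hypothesis vE : forall x : Q, x != 0 -> v (x%:A : K)%:A = vp x.
Hypothesis complete : forall u, val_cauchy vp u -> exists l, val_cvg vp u l.
Variable t : K.
Hypotheses (t0 : t != 0) (vt : 0 < v t%:A).
Hypothesis t_unif : forall x : L, val_gt v 0 x -> val_ge v (v t%:A) x.

Local Notation vK := (base_val v).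
Local Notation hvK := (base_valuation hv).
Local Notation vKE := (@base_valE K L v).

(** If [x] were outside [V], then [x] followed by a basis of [V] over [Q] would be free, and
    [bounded_coords] would force the coefficient 1 of [x] in [x - s] to be small. *)
Lemma subspace_closed (V : {vspace L}) x :
  (forall m : nat, exists2 s, s \in V & val_ge v m%:R (x - s)) -> x \in V.
Proof.
move=> hx; apply/negPn/negP => xV.
pose L0 : fieldExtType Q := baseFieldType L.
pose V0 : {vspace L0} := baseVspace V; pose X : seq L0 := x :: vbasis V0.
have fX : free X.
  rewrite free_cons (basis_free (vbasisP V0)) andbT.
  by rewrite (span_basis (vbasisP V0)) mem_baseVspace.
have vE0 : forall a : Q, a != 0 -> (v : L0 -> rat) a%:A = vp a by exact: vE.
have [C hC] := @bounded_coords Q vp L0 v hvp hv vE0 complete X fX.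
have [m hm] := rat_lt_nat C.
have [s sV xs] := hx m; have sV0 : (s : L0) \in V0 by rewrite mem_baseVspace.
pose c (i : nat) : Q := if i is j.+1 then
  if insub j is Some j' then - coord (vbasis V0) j' (s : L0) else 0 else 1.
have : val_ge vp (m%:R - C) (c 0%N).
  apply: hC => //; rewrite /X /= big_ord_recl /= scale1r size_tuple.
  set S := (X in x + X); suff -> : S = - (s : L0) by exact: xs.
  rewrite [X in _ = - X](coord_vbasis sV0) -sumrN; apply: eq_bigr => i _.
  rewrite /= insubT /=; first by rewrite ltn_ord.
  move=> lt; rewrite scaleNr.
  by congr (- (coord _ _ _ *: _)); apply: val_inj.
rewrite val_geE ?oner_eq0 // (valuation1 hvp) subr_le0 leNgt.
by rewrite hm.
Qed.

(** Successive approximation with a maximal residually free family: by [t_unif] an error in the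
    maximal ideal is [t] times an integral element, to which the approximation applies again.
    Integral elements are thus limits of elements of the span, which is closed. *)
Lemma integral_basis : exists n (X : n.-tuple L), basis_of fullv X /\
  forall x, val_ge v 0 x = [forall i, val_ge vK 0 (coord X i x)].
Proof.
have [X hX approx] := residually_free_max hv.
have tA0 : t%:A != 0 :> L by rewrite scaler_eq0 oner_eq0 orbF.
have approx_t m x : val_ge v 0 x ->
    exists2 s, s \in <<X>>%VS & val_ge v (v t%:A *+ m) (x - s).
  elim: m x => [|m IHm] x xO; first by exists 0; rewrite ?mem0v // subr0.
  have [c cO hc] := approx x xO; set s := \sum_i _ in hc.
  have sX : s \in <<X>>%VS.
    by apply: memv_suml => i _; apply/memvZ/memv_span/mem_nth.
  have [|s' s'X hs'] := IHm ((t%:A)^-1 * (x - s)).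
    rewrite -(addNr (v t%:A)); apply: (val_geM hv); last exact: t_unif.
    by rewrite val_geE ?invr_eq0 // (valuationV hv).
  exists (s + t *: s'); first by rewrite memvD // memvZ.
  have -> : x - (s + t *: s') = t%:A * ((t%:A)^-1 * (x - s) - s').
    by rewrite mulrBr mulVKf // mulr_algl opprD addrA.
  by rewrite mulrS; apply: (val_geM hv) => //; rewrite val_geE.
have span_int x : val_ge v 0 x -> x \in <<X>>%VS.
  move=> xO; apply: subspace_closed => m.
  have [N hN] := rat_le_nat (m%:R / v t%:A).
  have [s sX hs] := approx_t N x xO; exists s => //.
  by apply: val_geW hs _; rewrite -[v _ *+ N]mulr_natl -ler_pdivrMr.
have spanX x : x \in <<X>>%VS.
  have [N hN] := rat_le_nat (- v x / v t%:A).
  rewrite -[x](scalerK (expf_neq0 N t0)); apply/memvZ/span_int.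
  rewrite -mulr_algl; have [-> | x0] := eqVneq x 0; first by rewrite mulr0 val_ge0.
  rewrite val_geE ?mulf_neq0 ?scaler_eq0 ?oner_eq0 ?orbF ?expf_neq0 //.
  rewrite (valuationM hv) ?scaler_eq0 ?oner_eq0 ?orbF ?expf_neq0 //.
  have -> : v (t ^+ N)%:A = vK t *+ N by apply: (valuationX hvK).
  by rewrite -lerBlDr sub0r -[vK t *+ N]mulr_natl -ler_pdivrMr.
have bX : basis_of fullv (in_tuple X).
  rewrite /basis_of (residually_free_free hv) // andbT eqEsubv subvf /=.
  by apply/subvP => x _.
exists (size X), (in_tuple X); split=> // x; apply/idP/forallP => [xO|].
  rewrite {1}(coord_span (X := in_tuple X) (spanX x)) in xO => i.
  exact: (residually_free_coord hv hX xO).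
move=> cO; rewrite (coord_span (X := in_tuple X) (spanX x)).
apply: (val_ge_sum hv) => i _; rewrite -mulr_algl; apply: (val_ge0M hv).
  by rewrite (val_ge_alg vKE).
by apply: hX.1; apply: mem_nth.
Qed.

End IntegralBasis.

(** * Identities in a Hopf-Galois structure *)

Lemma linear_tlift (K : fieldType) (V W X Y : vectType K) (g : {linear X -> Y})
    (f : V -> W -> X) t : g (tlift f t) = tlift (fun a b => g (f a b)) t.
Proof.
rewrite /tlift linear_sum; apply: eq_bigr => i _.
by rewrite linear_sum; apply: eq_bigr => j _; rewrite linearZ.
Qed.

Lemma eq_tlift (K : fieldType) (V W X : vectType K) (f g : V -> W -> X) t :
  (forall a b, f a b = g a b) -> tlift f t = tlift g t.
Proof. by move=> fg; apply: eq_bigr => i _; apply: eq_bigr => j _; rewrite fg. Qed.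

Lemma tliftE (K : fieldType) (V W X : vectType K) (f : V -> W -> X) t :
  tlift f t = \sum_(q : 'I_(\dim {:V}) * 'I_(\dim {:W}))
    t q.1 q.2 *: f (vbasis {:V})`_q.1 (vbasis {:W})`_q.2.
Proof. by rewrite /tlift pair_bigA. Qed.

Lemma exchange22 (V : nmodType) (I1 I2 J1 J2 : finType)
    (F : I1 -> I2 -> J1 -> J2 -> V) :
  \sum_i1 \sum_i2 \sum_j1 \sum_j2 F i1 i2 j1 j2 =
  \sum_j1 \sum_j2 \sum_i1 \sum_i2 F i1 i2 j1 j2.
Proof.
have pairs (A1 A2 B1 B2 : finType) (G : A1 -> A2 -> B1 -> B2 -> V) :
    \sum_i1 \sum_i2 \sum_j1 \sum_j2 G i1 i2 j1 j2 =
    \sum_(i : A1 * A2) \sum_(j : B1 * B2) G i.1 i.2 j.1 j.2.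
  by rewrite pair_bigA; apply: eq_bigr => i _; rewrite pair_bigA.
by rewrite !pairs exchange_big.
Qed.

Section HopfGalois.
Variables (K : fieldType) (H : falgType K) (hs : hopf_structure H).
Variables (L : fieldExtType K) (act : {linear H -> 'End(L)}).
Hypothesis hHG : hopf_galois hs act.
Variables (n : nat) (X : n.-tuple L).
Hypothesis hX : basis_of fullv X.

Local Notation f_ := (vbasis {:H}).
Local Notation e_ := (vbasis {:L}).

Let actM h k x : act (h * k) x = act h (act k x).
Proof. by have [[_ -> _ _] _] := hHG; rewrite comp_lfunE. Qed.
Let act1 x : act 1 x = x.
Proof. by have [[-> _ _ _] _] := hHG; rewrite id_lfunE. Qed.
Let act_mul h s t :
  act h (s * t) = tlift (fun h1 h2 => act h1 s * act h2 t) (comul hs h).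
Proof. by have [[_ _ -> _] _] := hHG. Qed.
Let actD h k x : act (h + k) x = act h x + act k x.
Proof. by rewrite linearD add_lfunE. Qed.
Let actZ a h x : act (a *: h) x = a *: act h x.
Proof. by rewrite linearZ scale_lfunE. Qed.
Let act_sum (I : finType) (h : I -> H) x : act (\sum_i h i) x = \sum_i act (h i) x.
Proof. by rewrite linear_sum sum_lfunE. Qed.

Lemma act_eval_linear x : linear (fun h => act h x).
Proof. by move=> a h k; rewrite actD actZ. Qed.

Lemma coordE x : x = \sum_(i < n) coord X i x *: X`_i.
Proof. exact: (vector.coord_basis hX (memvf x)). Qed.

Lemma coord_delta (i j : 'I_n) : coord X i X`_j = (i == j)%:R.
Proof. by rewrite coord_free ?(basis_free hX) // eq_sym. Qed.

Lemma galois_mapE t x :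
  galois_map act t x = \sum_i \sum_j t i j *: (e_`_i * act f_`_j x).
Proof.
rewrite /galois_map /tlift sum_lfunE; apply: eq_bigr => i _.
rewrite sum_lfunE; apply: eq_bigr => j _; rewrite scale_lfunE.
congr (_ *: _); exact: (lfunE (e_`_i \*o act f_`_j)).
Qed.

Lemma galois_onto (f : 'End(L)) : exists h : 'I_n -> H,
  forall x, f x = \sum_(i < n) X`_i * act (h i) x.
Proof.
have [_ [g _ gK]] := hHG; pose t := g f.
exists (fun i : 'I_n => \sum_a \sum_b (t a b * coord X i e_`_a) *: f_`_b) => x.
rewrite -{1}(gK f) galois_mapE -/t.
under [RHS]eq_bigr => i _.
  rewrite act_sum mulr_sumr; under eq_bigr => a _.
    rewrite act_sum mulr_sumr; under eq_bigr => b _ do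
      rewrite actZ -scalerA -scalerAr -[X in _ *: X]scalerAr scalerAl.
    over.
  over.
rewrite [RHS]exchange_big; apply: eq_bigr => a _ /=.
rewrite [RHS]exchange_big; apply: eq_bigr => b _ /=.
rewrite -scaler_sumr; congr (_ *: _); rewrite -mulr_suml.
by congr (_ * _); rewrite {1}(coordE e_`_a).
Qed.

Lemma galois_inj (h : 'I_n -> H) :
  (forall x, \sum_(i < n) X`_i * act (h i) x = 0) -> forall i, h i = 0.
Proof.
move=> h0; have [_ [g galK _]] := hHG.
pose t : tens L H := \matrix_(a, b) \sum_(i < n) coord e_ a X`_i * coord f_ b (h i).
have t0 : t = 0.
  rewrite -(galK t) -(galK 0); congr (g _); apply/lfunP => x.
  rewrite !galois_mapE [RHS]big1 => [|a _]; last first.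
    by rewrite big1 // => b _; rewrite mxE scale0r.
  rewrite -[RHS](h0 x).
  under eq_bigr => a _ do under eq_bigr => b _ do rewrite mxE scaler_suml.
  under [RHS]eq_bigr => i _.
    rewrite {1}(coord_vbasis (memvf X`_i)) {1}(coord_vbasis (memvf (h i))).
    rewrite act_sum mulr_suml.
    under eq_bigr => a _.
      rewrite mulr_sumr.
      under eq_bigr => b _ do rewrite actZ -scalerAl -scalerAr scalerA.
      over.
    over.
  rewrite [RHS]exchange_big; apply: eq_bigr => a _ /=.
  by rewrite [RHS]exchange_big.
move=> i; rewrite (coord_vbasis (memvf (h i))) big1 // => b _.
suff -> : coord f_ b (h i) = 0 by rewrite scale0r.
pose c j := coord f_ b (h j); rewrite -/(c i).
have /freeP fX := basis_free hX; move: i; apply: (fX c).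
rewrite (coord_vbasis (memvf (\sum_(j < n) c j *: X`_j))) big1 // => a _.
move/matrixP/(_ a b): t0; rewrite !mxE => t0.
rewrite linear_sum -[X in X *: _]/(\sum_j _) (eq_bigr _ (fun j _ => linearZ _ _)) /=.
by under eq_bigr do rewrite mulrC; rewrite t0 scale0r.
Qed.

(** An element sum a_s (x) h_s of L (x) H that acts as zero is zero, so 1 (x) psi kills it.
    Relations between operators on [L] thereby become relations between the values of any linear
    function of the h_s. *)
Lemma galois_linear (I : finType) (a : I -> L) (h : I -> H) (psi : H -> L) :
  linear psi -> (forall x, \sum_s a s * act (h s) x = 0) ->
  \sum_s a s * psi (h s) = 0.
Proof.
move=> psil h0.
pose psiL : {linear H -> L} := HB.pack psi (GRing.isLinear.Build _ _ _ _ psi psil).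
pose h' i := \sum_s coord X i (a s) *: h s.
have swap (g : {linear H -> L}) : \sum_s a s * g (h s) = \sum_(i < n) X`_i * g (h' i).
  under [RHS]eq_bigr => i _ do rewrite linear_sum mulr_sumr.
  rewrite exchange_big; apply: eq_bigr => s _ /=.
  rewrite {1}(coordE (a s)) mulr_suml; apply: eq_bigr => i _.
  by rewrite linearZ -scalerAr -scalerAl.
have h'0 : forall i, h' i = 0.
  apply: galois_inj => x.
  pose ev : {linear H -> L} := HB.pack (fun h => act h x)
    (GRing.isLinear.Build _ _ _ _ _ (act_eval_linear x)).
  by apply: etrans (h0 x); symmetry; exact: (swap ev).
rewrite -[LHS]/(\sum_s a s * psiL (h s)) swap big1 // => i _.
by rewrite h'0 linear0 mulr0.
Qed.

(** The Galois map embeds L (x) H in End(L), so dim L times dim H is at most the square of dim L. *)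
Lemma dim_hopf_le : (\dim {:H} <= n)%N.
Proof.
have dL : \dim {:L} = n by rewrite -(span_basis hX) (eqP (basis_free hX)) size_tuple.
have [_ [g galK _]] := hHG.
pose gm : 'Hom(tens L H, 'End(L)) := linfun
  (HB.pack (galois_map act) (GRing.isLinear.Build _ _ _ _ _ (tlift_linear _))
    : {linear tens L H -> 'End(L)}).
have ker0 : lker gm == 0%VS.
  apply/lker0P => s t; rewrite !lfunE /= => e.
  by rewrite -(galK s) e galK.
have e : \dim (gm @: fullv) = \dim {: 'M[K]_(\dim {:L}, \dim {:H})}.
  by apply: limg_dim_eq; rewrite (eqP ker0) capv0.
have := dimvS (subvf (gm @: fullv)%VS); rewrite e => le.
have {le} : (\dim {:L} * \dim {:H} <= \dim {:L} * \dim {:L})%N.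
  by rewrite !dimvf in le *.
by rewrite dL leq_pmul2l // -dL adim_gt0.
Qed.

(** * Expansion of the coordinate forms through the action *)

Section DualBasis.
Variable hh : 'I_n -> 'I_n -> H.
Hypothesis hhE : forall j x,
  (coord X j x)%:A = \sum_(m < n) X`_m * act (hh j m) x :> L.

(* 1 (x) h = sum_(j, m) h(w_j) w_m (x) h_jm, evaluated under h'. *)
Lemma act_expansion h' h x : act h' (act h x) =
  \sum_(s : 'I_n * 'I_n) X`_s.2 * act h X`_s.1 * act h' (act (hh s.1 s.2) x).
Proof.
(* The index [None] carries the extra term -1 (x) h of the relation. *)
pose I : finType := option ('I_n * 'I_n).
pose a (s : I) : L := if s is Some s' then X`_s'.2 * act h X`_s'.1 else -1.
pose k (s : I) : H := if s is Some s' then hh s'.1 s'.2 else h.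
have psil : linear (fun k => act h' (act k x)).
  by move=> c u w; rewrite actD actZ linearP.
have split (F : H -> L) : \sum_s a s * F (k s) =
    - F h + \sum_(s : 'I_n * 'I_n) X`_s.2 * act h X`_s.1 * F (hh s.1 s.2).
  rewrite (bigD1 None) //= mulN1r; congr (_ + _).
  rewrite (reindex_omap Some id) => [|[]//]; apply: eq_bigl => s /=.
  by rewrite eqxx.
apply/esym/eqP; rewrite -subr_eq0 addrC; apply/eqP.
apply: etrans (esym (split (fun k => act h' (act k x)))) (galois_linear psil _) => y.
apply: etrans (split (fun k => act k y)) _; apply/eqP; rewrite addrC subr_eq0; apply/eqP.
rewrite [in RHS](coordE y) linear_sum.
rewrite -(pair_bigA _ (fun j m : 'I_n => X`_m * act h X`_j * act (hh j m) y)) /=.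
apply: eq_bigr => j _.
rewrite linearZZ -mulr_algl hhE mulr_suml; apply: eq_bigr => m _.
by rewrite mulrAC.
Qed.

(** Both sides encode tensors in L (x) L (x) L. Testing with [h] and [h'] on the last two factors
    determines the coordinates there, since each coordinate form is an [L]-combination of operators
    from [H]. *)
Lemma tensor_coords (I J : finType) (a b c : I -> L) (a' b' c' : J -> L) :
  (forall h h', \sum_s a s * act h (b s) * act h' (c s) =
                \sum_s a' s * act h (b' s) * act h' (c' s)) ->
  forall i j, \sum_s a s * (coord X i (b s))%:A * (coord X j (c s))%:A =
              \sum_s a' s * (coord X i (b' s))%:A * (coord X j (c' s))%:A.
Proof.
move=> e i j.
have expand (S : finType) (x y z : S -> L) :
    \sum_s x s * (coord X i (y s))%:A * (coord X j (z s))%:A =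
    \sum_(m < n) \sum_(m' < n) X`_m * X`_m' *
      \sum_s x s * act (hh i m) (y s) * act (hh j m') (z s).
  under eq_bigr => s _ do rewrite hhE mulr_sumr mulr_suml.
  rewrite exchange_big; apply: eq_bigr => m _.
  under eq_bigr => s _ do rewrite hhE mulr_sumr.
  rewrite exchange_big; apply: eq_bigr => m' _ /=.
  by rewrite mulr_sumr; apply: eq_bigr => s _; ring.
rewrite (expand I a b c) (expand J a' b' c').
by apply: eq_bigr => m _; apply: eq_bigr => m' _; rewrite e.
Qed.

(** Multiplicativity of Theta, tested under [h] and [h']: the product is split by the
    comultiplication, and [act_expansion] is applied to each factor. *)
Lemma expansion_mul h h' x y :
  \sum_(s : 'I_n * 'I_n) \sum_(u : 'I_n * 'I_n)
    (X`_s.2 * X`_u.2) * act h (X`_s.1 * X`_u.1) *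
    act h' (act (hh s.1 s.2) x * act (hh u.1 u.2) y) = act h' (act h (x * y)).
Proof.
rewrite act_mul linear_tlift tliftE.
under [RHS]eq_bigr => q _ do rewrite /= act_mul tliftE scaler_sumr.
under [RHS]eq_bigr => q _ do under eq_bigr => r _ do
  rewrite /= 2!act_expansion mulr_suml scaler_sumr scaler_sumr.
under [RHS]eq_bigr => q _ do under eq_bigr => r _ do under eq_bigr => s _ do
  rewrite mulr_sumr scaler_sumr scaler_sumr.
rewrite [RHS]exchange22; apply: eq_bigr => s _; apply: eq_bigr => u _.
rewrite !act_mul !tliftE -mulrA mulr_suml mulr_sumr; apply: eq_bigr => q _.
rewrite !mulr_sumr; apply: eq_bigr => r _ /=.
by rewrite -scalerAl -!scalerAr; congr (_ *: (_ *: _)); ring.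
Qed.

End DualBasis.

Lemma galois_free (c : 'I_(\dim {:H}) -> L) :
  (forall x, \sum_a c a * act f_`_a x = 0) -> forall a, c a = 0.
Proof.
move=> c0 a.
have coordl : linear (fun h => (coord f_ a h)%:A : L).
  by move=> b u w; rewrite linearP scalerDl scalerA.
rewrite -[RHS](galois_linear coordl c0) (bigD1 a) //= big1 => [|b ba].
  by rewrite coord_free ?(basis_free (vbasisP _)) // eqxx scale1r mulr1 addr0.
by rewrite coord_free ?(basis_free (vbasisP _)) // (negPf ba) scale0r mulr0.
Qed.

(** Cocommutativity comes from st = ts in [L]: the comultiplication minus its flip annihilates all
    pairs s, t, and [galois_free], used twice, strips the two factors. *)
Lemma comul_sym h a b : comul hs h a b = comul hs h b a.
Proof.
pose D a b := comul hs h a b - comul hs h b a; apply/eqP; rewrite -subr_eq0.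
have D0 s t : \sum_a \sum_b D a b *: (act f_`_a s * act f_`_b t) = 0.
  rewrite /D; under eq_bigr => a' _ do under eq_bigr => b' _ do rewrite scalerBl.
  under eq_bigr => a' _ do rewrite sumrB.
  rewrite sumrB -[X in X - _]/(tlift (fun h1 h2 => act h1 s * act h2 t) (comul hs h)).
  rewrite -act_mul mulrC act_mul /tlift exchange_big /=; apply/eqP.
  rewrite subr_eq0; apply/eqP; apply: eq_bigr => a' _; apply: eq_bigr => b' _.
  by rewrite mulrC.
have /eqP : (D a b)%:A = 0 :> L.
  move: b; apply: galois_free => t.
  rewrite (eq_bigr (fun b => D a b *: act f_`_b t)) => [|b _]; last first.
    by rewrite mulr_algl.
  pose c a := \sum_b D a b *: act f_`_b t; rewrite -/(c a).
  move: a; apply: galois_free => s; rewrite -[RHS](D0 s t); apply: eq_bigr => a _.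
  rewrite mulr_suml; apply: eq_bigr => b _.
  by rewrite -scalerAl mulrC.
by rewrite scaler_eq0 oner_eq0 orbF.
Qed.

(** By coassociativity the right side is the sum of h_(1) x times h_(2) S(h_(3)) y, and the antipode
    and counit axioms collapse it. [phi] evaluates a (x) b (x) c as (a x)(b S(c) y). *)
Lemma act_mul_antipode h x y : act h x * y =
  tlift (fun a b => act a (x * act (antipode hs b) y)) (comul hs h).
Proof.
pose psi := tlift (fun a b => act (a * antipode hs b) y) : 'M_(_, _) -> L.
pose psiL : {linear tens H H -> L} :=
  HB.pack psi (GRing.isLinear.Build _ _ _ _ _ (tlift_linear _)).
pose phi := tlift (fun a (t : tens H H) => act a x * psiL t) : 'M_(_, _) -> L.
pose phiL : {linear tens H (tens H H) -> L} :=
  HB.pack phi (GRing.isLinear.Build _ _ _ _ _ (tlift_linear _)).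
have psiE a b : psiL (tensv a b) = act (a * antipode hs b) y.
  apply: tlift_tensv; split=> [c|c] k u w.
    by rewrite mulrDl -scalerAl actD actZ.
  by rewrite linearP mulrDr -scalerAr actD actZ.
have phiE a t : phiL (tensv a t) = act a x * psiL t.
  apply: tlift_tensv; split=> [c|c] k u w.
    by rewrite actD actZ mulrDl scalerAl.
  by rewrite linearP mulrDr scalerAr.
have := congr1 phiL (comul_coassoc hs h).
rewrite !linear_tlift => coassoc.
transitivity (tlift (fun a b => phiL (tensv a (comul hs b))) (comul hs h)).
  pose ev z : {linear H -> L} := HB.pack (fun k => act k z)
    (GRing.isLinear.Build _ _ _ _ _ (act_eval_linear z)).
  have psi_comul b : psiL (comul hs b) = (counit hs b : K) *: y.
    have := linear_tlift (ev y) (fun a b => a * antipode hs b) (comul hs b).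
    by rewrite antipoder /= actZ act1 => e; apply: etrans (esym e) _.
  rewrite -{1}(comul_counitr hs h) -[act _ x]/(ev x _) linear_tlift /tlift mulr_suml.
  apply: eq_bigr => i _; rewrite mulr_suml; apply: eq_bigr => j _.
  by rewrite phiE psi_comul linearZZ -!scalerAl scalerAr.
rewrite -coassoc; apply: eq_tlift => a b.
rewrite act_mul linear_tlift; apply: eq_tlift => a1 a2.
by rewrite phiE psiE actM.
Qed.

Definition ltrace (g : L -> L) : K := \sum_(i < n) coord X i (g X`_i).
Definition ftrace (x : L) : K := ltrace (fun y => x * y).

Lemma ltrace_comp (f g : 'End(L)) :
  ltrace (fun y => f (g y)) = ltrace (fun y => g (f y)).
Proof.
rewrite /ltrace; under eq_bigr => i _ do
  rewrite {1}(coordE (g X`_i)) linear_sum linear_sum.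
rewrite exchange_big; apply: eq_bigr => i _ /=.
rewrite [in RHS](coordE (f X`_i)) !linear_sum; apply: eq_bigr => j _.
by rewrite [in LHS]linearZZ [in RHS]linearZZ !linearZ /= mulrC.
Qed.

Lemma ftrace_linear a x y : ftrace (a *: x + y) = a * ftrace x + ftrace y.
Proof.
rewrite /ftrace /ltrace mulr_sumr -big_split; apply: eq_bigr => i _ /=.
by rewrite mulrDl -scalerAl linearP.
Qed.

Lemma ftrace1 : ftrace 1 = n%:R.
Proof.
rewrite /ftrace /ltrace (eq_bigr (fun=> 1)) ?sumr_const ?card_ord // => i _.
by rewrite mul1r coord_delta eqxx.
Qed.

(** By [act_mul_antipode], multiplication by h x is the sum of h_(1) after multiplication by x after
    S(h_(2)). Cyclicity of the trace brings S(h_(2)) in front of h_(1), and cocommutativity turns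
    S(h_(2)) h_(1) into S(h_(1)) h_(2), which is the counit. *)
Lemma ftrace_act h x : ftrace (act h x) = (counit hs h : K) * ftrace x.
Proof.
pose D := comul hs h; pose mx : 'End(L) := linfun (x \*o idfun).
have mulE y : mx y = x * y by rewrite lfunE.
pose tr k : K^o := \sum_(i < n) coord X i (act k (mx X`_i)).
have trl : linear tr.
  move=> a u w; rewrite /tr scaler_sumr -big_split; apply: eq_bigr => i _ /=.
  by rewrite actD actZ linearP.
pose trL : {linear H -> K^o} := HB.pack tr (GRing.isLinear.Build _ _ _ _ _ trl).
transitivity (tlift (fun a b => tr (antipode hs b * a)) D : K^o).
  rewrite /ftrace /ltrace.
  have coord_tlift i (f : H -> H -> L) u :
      coord X i (tlift f u) = tlift (fun a b => coord X i (f a b) : K^o) u.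
    exact: (linear_tlift (coord X i : {linear L -> K^o})).
  under eq_bigr => i _ do rewrite act_mul_antipode coord_tlift tliftE.
  rewrite exchange_big tliftE; apply: eq_bigr => q _ /=.
  apply: etrans (esym (mulr_sumr _ _ _ _)) _.
  rewrite -[RHS]/(D q.1 q.2 * tr (antipode hs f_`_q.2 * f_`_q.1)); congr (_ * _).
  have := ltrace_comp (act f_`_q.1 \o mx)%VF (act (antipode hs f_`_q.2)).
  rewrite /ltrace => e; transitivity (\sum_(i < n) coord X i
     ((act f_`_q.1 \o mx)%VF (act (antipode hs f_`_q.2) X`_i))).
    by apply: eq_bigr => i _; rewrite comp_lfunE mulE.
  by rewrite e; apply: eq_bigr => i _; rewrite comp_lfunE actM.
have -> : tlift (fun a b => tr (antipode hs b * a) : K^o) D =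
          tlift (fun a b => trL (antipode hs a * b)) D.
  rewrite /tlift exchange_big; apply: eq_bigr => b _; apply: eq_bigr => a _.
  by rewrite /D comul_sym.
rewrite -linear_tlift antipodel linearZ /=; congr (_ * _).
by apply: eq_bigr => i _; rewrite act1 mulE.
Qed.

(** In the trace of [act_mul_antipode], the outer h_(1) contributes only its counit, by
    [ftrace_act]. *)
Lemma ftrace_adjoint h x y :
  ftrace (act h x * y) = ftrace (x * act (antipode hs h) y).
Proof.
pose trL : {linear L -> K^o} := HB.pack (ftrace : L -> K^o)
  (GRing.isLinear.Build _ _ _ _ (ftrace : L -> K^o) ftrace_linear).
pose psi k := x * act (antipode hs k) y.
have psil : linear psi by move=> a u w; rewrite /psi linearP actD actZ mulrDr scalerAr.
pose psiL : {linear H -> L} := HB.pack psi (GRing.isLinear.Build _ _ _ _ _ psil).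
rewrite act_mul_antipode -[LHS]/(trL _) linear_tlift.
rewrite -[in RHS](comul_counitl hs h) -[RHS]/(trL (psiL _)) !linear_tlift.
apply: eq_bigr => i _; apply: eq_bigr => j _.
apply: (congr1 (GRing.mul _)).
by rewrite (linearZZ psiL) (linearZZ trL); apply: ftrace_act.
Qed.

End HopfGalois.

(** * Cyclic modules over finite fields *)

Section FiniteCyclic.
Variables (k : finFieldType) (n : nat) (B : {set 'M[k]_n}) (M : 'I_n -> 'M[k]_n).
Hypothesis B_scalar : forall c : k, c%:M \in B.
Hypothesis B_add : forall a b, a \in B -> b \in B -> a + b \in B.
Hypothesis B_mul : forall a b, a \in B -> b \in B -> a *m b \in B.
Hypothesis B_card : (#|B| <= #|k| ^ n)%N.
Hypothesis B_gen : forall F : 'M[k]_n, exists b : 'I_n -> 'M[k]_n,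
  (forall j, b j \in B) /\ F = \sum_j M j *m b j.

Let comb (b : {ffun 'I_n -> 'M[k]_n}) := \sum_j M j *m b j.

Let scal0 : (0 : k)%:M = 0 :> 'M_n. Proof. exact: raddf0. Qed.
Let B0 : 0 \in B. Proof. by rewrite -scal0 B_scalar. Qed.
Let B1 : 1%:M \in B. Proof. exact: B_scalar. Qed.
Let B_sum (I : finType) (f : I -> 'M[k]_n) :
  (forall i, f i \in B) -> \sum_i f i \in B.
Proof. by move=> hf; elim/big_ind: _ => //; exact: B_add. Qed.

Let comb_onto F : exists2 b, b \in ffun_on (mem B) & F = comb b.
Proof.
have [b [bB ->]] := B_gen F; exists [ffun j => b j].
  by apply/ffun_onP => j; rewrite ffunE.
by apply: eq_bigr => j _; rewrite ffunE.
Qed.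

(* Surjective between sets of the same cardinality, hence injective. *)
Let comb_inj : {in ffun_on (mem B) &, injective comb}.
Proof.
apply/imset_injP; rewrite eqn_leq leq_imset_card /=.
have -> : comb @: ffun_on (mem B) = setT.
  apply/setP => F; rewrite inE; have [b bB ->] := comb_onto F.
  exact: imset_f.
rewrite cardsT card_mx card_ffun_on card_ord expnM.
have pow a b e : (a <= b -> a ^ e <= b ^ e)%N by case: e => // e ab; rewrite leq_exp2r.
exact: pow.
Qed.

Let dec F : exists b, b \in ffun_on (mem B) /\ comb b = F.
Proof. by have [b bB ->] := comb_onto F; exists b. Qed.
(** [beta F j] is the coordinate in [B] of [F] along [M j]; by uniqueness these coordinates are
    right [B]-linear. *)
Let beta F := projT1 (cid (dec F)).
Let beta_on F : beta F \in ffun_on (mem B) := (projT2 (cid (dec F))).1.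
Let betaB F j : beta F j \in B. Proof. by move/ffun_onP: (beta_on F); apply. Qed.
Let betaK F : F = \sum_j M j *m beta F j.
Proof. by rewrite -{1}((projT2 (cid (dec F))).2). Qed.

Let beta_uniq F (b : 'I_n -> 'M[k]_n) : (forall j, b j \in B) ->
  F = \sum_j M j *m b j -> forall j, beta F j = b j.
Proof.
move=> bB Fb j; rewrite -[RHS](ffunE (fun j => b j)); move: j; apply/ffunP.
apply: comb_inj; [exact: beta_on | by apply/ffun_onP => i; rewrite ffunE |].
by rewrite /comb -betaK Fb; apply: eq_bigr => i _; rewrite ffunE.
Qed.

Let betaM F b j : b \in B -> beta (F *m b) j = beta F j *m b.
Proof.
move=> bB; move: j; apply: beta_uniq => [j|]; first exact: B_mul.
by rewrite {1}(betaK F) mulmx_suml; apply: eq_bigr => j _; rewrite mulmxA.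
Qed.

Let beta_sum (I : finType) (F : I -> 'M[k]_n) j :
  beta (\sum_i F i) j = \sum_i beta (F i) j.
Proof.
move: j; apply: beta_uniq => [j|]; first by apply: B_sum => i.
under [RHS]eq_bigr do rewrite mulmx_sumr.
by rewrite exchange_big; apply: eq_bigr => i _; rewrite -betaK.
Qed.

Let betaZ c F j : beta (c *: F) j = c *: beta F j.
Proof. by rewrite -!mul_mx_scalar betaM. Qed.

(** [B] acts on row vectors V from the right, so a matrix commuting with [B] is a [B]-endomorphism;
    [hom Y] is Hom_B(V, Y) and [orb x] the submodule generated by [x]. *)
Let submod (Y : {set 'rV[k]_n}) :=
  [/\ 0 \in Y, forall x y, x \in Y -> y \in Y -> x + y \in Y
    & forall x b, x \in Y -> b \in B -> x *m b \in Y].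
Let comm (f : 'M[k]_n) := [forall b in B, b *m f == f *m b].
Let im (f : 'M[k]_n) := [set x *m f | x : 'rV[k]_n].
Let orb (x : 'rV[k]_n) := [set x *m b | b in B].
Let hom (Y : {set 'rV[k]_n}) := [set f | comm f && (im f \subset Y)].

Let commP f : reflect {in B, forall b, b *m f = f *m b} (comm f).
Proof. exact: eqfun_inP. Qed.

Let homP (Y : {set 'rV[k]_n}) f :
  reflect ({in B, forall b, b *m f = f *m b} /\ forall x, x *m f \in Y)
    (f \in hom Y).
Proof.
rewrite inE; apply: (iffP andP) => [[/commP fB /subsetP fY]|[fB fY]].
  by split=> // x; apply/fY/imset_f.
by split; [exact/commP | apply/subsetP => _ /imsetP[x _ ->]].
Qed.

Let submod_sum (Y : {set 'rV[k]_n}) (I : finType) (f : I -> 'rV[k]_n) : submod Y ->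
  (forall i, f i \in Y) -> \sum_i f i \in Y.
Proof. by move=> [Y0 YD _] hf; elim/big_ind: _. Qed.

(** A matrix is read as its tuple of rows, an element of V^n, and [phi] as the components of a map
    from V^n to V. If these commute with [B], the map is determined by its values on the [M j], by
    [extE]. *)
Let ext (phi : 'I_n -> 'M[k]_n) (F : 'M[k]_n) : 'rV[k]_n :=
  \sum_i row i F *m phi i.

Let extE phi F : (forall i, comm (phi i)) ->
  ext phi F = \sum_j ext phi (M j) *m beta F j.
Proof.
move=> hphi; rewrite {1}/ext {1}(betaK F).
under eq_bigr do rewrite raddf_sum mulmx_suml.
rewrite exchange_big; apply: eq_bigr => j _; rewrite mulmx_suml.
apply: eq_bigr => i _; rewrite /= row_mul -!mulmxA.
by rewrite (commP _ (hphi i)).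
Qed.

Let unit_row i (x : 'rV[k]_n) : 'M[k]_n := delta_mx i (0 : 'I_1) *m x.

Let row_unit_row i j x : row j (unit_row i x) = (j == i)%:R *: x.
Proof.
apply/rowP => a; rewrite !mxE big_ord_recl big_ord0 addr0 !mxE eqxx andbT.
by [].
Qed.

Let ext_unit_row phi i x : ext phi (unit_row i x) = x *m phi i.
Proof.
rewrite /ext (bigD1 i) //= row_unit_row eqxx scale1r big1 ?addr0 // => j ji.
by rewrite row_unit_row (negPf ji) scale0r mul0mx.
Qed.

(** The component on the [i]-th row of the [B]-linear map from matrices to V that sends each [M j]
    to [y j]. *)
Let lift_hom (y : 'I_n -> 'rV[k]_n) (i : 'I_n) : 'M[k]_n :=
  \matrix_a \sum_j y j *m beta (delta_mx i a) j.

Let lift_homE y i x : x *m lift_hom y i = \sum_j y j *m beta (unit_row i x) j.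
Proof.
have -> : unit_row i x = \sum_a x 0 a *: delta_mx i a.
  rewrite /unit_row {1}(row_sum_delta x) mulmx_sumr; apply: eq_bigr => a _.
  by rewrite -scalemxAr mul_delta_mx.
under eq_bigr do rewrite beta_sum mulmx_sumr.
rewrite exchange_big mulmx_sum_row; apply: eq_bigr => a _.
rewrite rowK scaler_sumr; apply: eq_bigr => j _.
by rewrite betaZ scalemxAr.
Qed.

Let unit_row_sum F : F = \sum_i unit_row i (row i F).
Proof.
apply/row_matrixP => j; rewrite raddf_sum (bigD1 j) //=.
rewrite row_unit_row eqxx scale1r big1 ?addr0 // => i ij.
by rewrite row_unit_row eq_sym (negPf ij) scale0r.
Qed.

(* End(V) = \bigoplus_j M_j B is, as a B-module, both V^n and free of rank n. *)
Lemma card_hom Y : (0 < n)%N -> submod Y -> #|hom Y| = #|Y|.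
Proof.
move=> n0 hY; have [Y0 YD YB] := hY.
have cf (T : finType) (A : {set T}) :
    #|(ffun_on (mem A) : {pred {ffun 'I_n -> T}})| = (#|A| ^ n)%N.
  by rewrite card_ffun_on card_ord.
(* Comparing n-th powers suffices: [Psi], evaluation on the basis [M], is a bijection from n-tuples
   of homomorphisms into [Y] onto n-tuples of elements of [Y]. *)
apply/eqP; rewrite -(eqn_exp2r _ _ n0) -!cf.
pose Psi (phi : {ffun 'I_n -> 'M[k]_n}) : {ffun 'I_n -> 'rV[k]_n} :=
  [ffun j => ext phi (M j)].
have homC phi i : phi \in ffun_on (mem (hom Y)) -> comm (phi i).
  by move/ffun_onP/(_ i); rewrite inE => /andP[].
have Psi_inj : {in ffun_on (mem (hom Y)) &, injective Psi}.
  move=> phi psi hphi hpsi e; apply/ffunP => i.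
  apply/row_matrixP => a; rewrite !rowE -!(ext_unit_row _ i).
  rewrite !extE => [|j|j]; try exact: homC.
  by apply: eq_bigr => j _; move/ffunP/(_ j): e; rewrite !ffunE => ->.
rewrite -(card_in_imset Psi_inj); apply/eqP/eq_card => y.
apply/imsetP/idP => [[phi hphi ->]|/ffun_onP yY].
  apply/ffun_onP => j; rewrite ffunE; apply: submod_sum => // i.
  by move/ffun_onP/(_ i)/homP: hphi => [_ ->].
have lhY i : lift_hom y i \in hom Y.
  apply/homP; split=> [b bB|x].
    apply/row_matrixP => a; rewrite !row_mul [in RHS]rowE rowE !lift_homE mulmx_suml.
    apply: eq_bigr => j _; rewrite -mulmxA -betaM // /unit_row.
    by rewrite !mulmxA.
  by rewrite lift_homE; apply: submod_sum => // j; apply: YB; [exact: yY | exact: betaB].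
exists [ffun i => lift_hom y i].
  by apply/ffun_onP => i; rewrite ffunE.
apply/ffunP => l; rewrite ffunE /ext.
under eq_bigr do rewrite ffunE lift_homE.
rewrite exchange_big /=.
under eq_bigr do rewrite -mulmx_sumr -beta_sum -unit_row_sum.
have beta_M j : beta (M l) j = (j == l)%:R%:M.
  apply: (beta_uniq (b := fun j => (j == l)%:R%:M)) => [i|]; first exact: B_scalar.
  rewrite (bigD1 l) //= eqxx mulmx1 big1 ?addr0 // => i il.
  by rewrite (negPf il) scal0 mulmx0.
rewrite (bigD1 l) //= beta_M eqxx mulmx1 big1 ?addr0 // => i il.
by rewrite beta_M (negPf il) scal0 mulmx0.
Qed.

Let submod_im f : comm f -> submod (im f).
Proof.
move=> /commP fB; split=> [|_ _ /imsetP[x _ ->] /imsetP[y _ ->]|_ b /imsetP[x _ ->] bB].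
- by apply/imsetP; exists 0; rewrite ?mul0mx.
- by apply/imsetP; exists (x + y); rewrite ?mulmxDl.
- by apply/imsetP; exists (x *m b); rewrite // -!mulmxA fB.
Qed.

Let submod_orb x : submod (orb x).
Proof.
split=> [|_ _ /imsetP[a aB ->] /imsetP[b bB ->]|_ b /imsetP[a aB ->] bB].
- by apply/imsetP; exists 0; rewrite ?mulmx0.
- by apply/imsetP; exists (a + b); rewrite ?mulmxDr ?B_add.
- by apply/imsetP; exists (a *m b); rewrite ?mulmxA ?B_mul.
Qed.

(* Moebius inversion over the submodules: the homomorphisms V -> Y and the
   elements of Y are equinumerous for every Y, hence so are those with full
   image and those generating Y. *)
Lemma card_onto (Y : {set 'rV[k]_n}) : (0 < n)%N -> submod Y ->
  #|[set f | comm f && (im f == Y)]| = #|[set x | orb x == Y]|.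
Proof.
move=> n0; have [m le] := ubnP #|Y|; elim: m Y le => // m IHm Y leY hY.
have orbY x : (orb x \subset Y) = (x \in Y).
  apply/subsetP/idP => [|xY _ /imsetP[b bB ->]]; last by case: hY => _ _; apply.
  by apply; apply/imsetP; exists 1%:M; rewrite ?mulmx1.
have := card_hom n0 hY.
rewrite -sum1_card (partition_big im (fun Z => Z \subset Y)) => [|f]; last first.
  by rewrite inE => /andP[].
rewrite -[RHS]sum1_card (partition_big orb (fun Z => Z \subset Y)) => [|x]; last first.
  by rewrite orbY.
rewrite (bigD1 Y) //= [in RHS](bigD1 Y) //=.
have toL (Z : {set 'rV[k]_n}) : Z \subset Y ->
    (\sum_(f in hom Y | im f == Z) 1 = #|[set f | comm f && (im f == Z)]|)%N.
  move=> ZY; rewrite sum1dep_card; apply: eq_card => f; rewrite !inE.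
  by case: eqP => [->|]; rewrite ?andbF // ZY !andbT.
have toR (Z : {set 'rV[k]_n}) : Z \subset Y ->
    (\sum_(x in Y | orb x == Z) 1 = #|[set x | orb x == Z]|)%N.
  move=> ZY; rewrite sum1dep_card; apply: eq_card => x; rewrite !inE.
  by case: eqP => [e|]; rewrite ?andbF // -orbY e ZY.
rewrite toL // toR // => /eqP.
(* The strata of proper subsets [Z] agree, by induction if [Z] is a submodule and because both are
   empty otherwise; what remains are the strata of [Y]. *)
suff -> : (\sum_(Z : {set 'rV[k]_n} | (Z \subset Y) && (Z != Y))
    \sum_(f in hom Y | im f == Z) 1 =
  \sum_(Z : {set 'rV[k]_n} | (Z \subset Y) && (Z != Y)) \sum_(x in Y | orb x == Z) 1)%N.
  by rewrite eqn_add2r => /eqP.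
apply: eq_bigr => Z /andP[ZY neZ]; rewrite toL // toR //.
have ltZ : (#|Z| < m)%N.
  by apply: leq_trans (proper_card _) leY; rewrite properEneq neZ.
case: (pselect (submod Z)) => [|nZ]; first exact: IHm.
rewrite !eq_card0 // => x; rewrite !inE; apply/negbTE/negP.
  by move/eqP => e; case: nZ; rewrite -e.
by case/andP => cx /eqP e; case: nZ; rewrite -e; apply: submod_im.
Qed.

(** The identity has full image, so [card_onto] for the whole space yields a generator. The case n =
    0 is separate because [card_hom] extracts an n-th root. *)
Lemma finite_cyclic : exists x : 'rV[k]_n, forall y, exists2 b, b \in B & y = x *m b.
Proof.
have [n0 | ] := posnP n.
  exists 0 => y; exists 0; rewrite ?B0 // mulmx0.
  by apply/rowP => i; have := ltn_ord i; rewrite {2}n0.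
move=> n0.
have hT : submod setT by split=> *; rewrite inE.
have := card_onto n0 hT; set S := [set f | _] => cS.
have : (0 < #|S|)%N.
  apply/card_gt0P; exists 1%:M; rewrite inE; apply/andP; split.
    by apply/commP => b _; rewrite mulmx1 mul1mx.
  by apply/eqP/setP => x; rewrite inE; apply/imsetP; exists x; rewrite ?mulmx1.
rewrite cS => /card_gt0P[x]; rewrite inE => /eqP e; exists x => y.
have : y \in orb x by rewrite e in_setT.
by case/imsetP => b bB ->; exists b.
Qed.

End FiniteCyclic.

(** * The associated order *)

Section IntegralStructure.
Variables (K : fieldType) (L : fieldExtType K) (v : L -> rat).
Hypothesis hv : valuation v.
Local Notation vK := (base_val v).
Let hvK : valuation vK := base_valuation hv.
Let vKE a : a != 0 -> v a%:A = vK a := @base_valE K L v a.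
Variables (t : K).
Hypotheses (t0 : t != 0) (vt : 0 < v t%:A).
Hypothesis t_unif : forall x : L, val_gt v 0 x -> val_ge v (v t%:A) x.
Variables (n : nat) (X : n.-tuple L).
Hypothesis hX : basis_of fullv X.
Hypothesis X_int : forall x, val_ge v 0 x = [forall i, val_ge vK 0 (coord X i x)].
Variables (k : finFieldType) (r : K -> k).
Hypothesis hr : residue_morphism vK r.

Let tL0 : t%:A != 0 :> L. Proof. by rewrite scaler_eq0 oner_eq0 orbF. Qed.

Lemma alg_ge c a : val_ge v c a%:A = val_ge vK c a.
Proof. exact: (val_ge_alg vKE). Qed.

Lemma alg_gt c a : val_gt v c a%:A = val_gt vK c a.
Proof. exact: (val_gt_alg vKE). Qed.

Lemma scale_int a x : val_ge vK 0 a -> val_ge v 0 x -> val_ge v 0 (a *: x).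
Proof. by move=> aO xO; rewrite -mulr_algl; apply: (val_ge0M hv); rewrite ?alg_ge. Qed.

Lemma coord_int i x : val_ge v 0 x -> val_ge vK 0 (coord X i x).
Proof. by rewrite X_int => /forallP. Qed.

Lemma basis_int i : val_ge v 0 X`_i.
Proof.
have [ni | ni] := leqP n i; first by rewrite nth_default ?size_tuple // val_ge0.
rewrite X_int; apply/forallP => j; rewrite (coord_delta hX j (Ordinal ni)).
by case: eqP => _; rewrite ?val_ge1 ?val_ge0.
Qed.

Lemma gt0_mult x : val_gt v 0 x -> exists2 y, val_ge v 0 y & x = t *: y.
Proof.
move=> /t_unif xt; exists (t^-1 *: x); last by rewrite scalerKV.
rewrite -mulr_algl -(addNr (v t%:A)); apply: (val_geM hv) => //.
rewrite val_geE ?scaler_eq0 ?oner_eq0 ?orbF ?invr_eq0 //.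
have -> : (t^-1)%:A = (t%:A)^-1 :> L by exact: (fmorphV (in_alg L)).
by rewrite (valuationV hv).
Qed.

Lemma t_gt : val_gt vK 0 t.
Proof. by rewrite val_gtE. Qed.

Lemma coord_gt i x : val_gt v 0 x -> val_gt vK 0 (coord X i x).
Proof.
move=> /gt0_mult[y yO ->]; rewrite linearZ /= mulrC.
by apply: (val_gtM hvK); rewrite ?t_gt ?coord_int.
Qed.

Lemma gt_coord x : (forall i, val_gt vK 0 (coord X i x)) -> val_gt v 0 x.
Proof.
move=> h; rewrite (coordE hX x); apply: (val_gt_sum hv) => i _.
by rewrite -mulr_algl mulrC; apply: (val_gtM hv); rewrite ?basis_int ?alg_gt.
Qed.

Definition lift (a : k) : K := projT1 (cid2 (res_onto hr a)).
Lemma lift_int a : val_ge vK 0 (lift a).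
Proof. by rewrite /lift; case: (cid2 _). Qed.
Lemma liftK a : r (lift a) = a.
Proof. by rewrite /lift; case: (cid2 _). Qed.

Definition lift_vec (u : 'I_n -> k) : L := \sum_i lift (u i) *: X`_i.

Lemma coord_lift_vec u i : coord X i (lift_vec u) = lift (u i).
Proof.
rewrite /lift_vec linear_sum (bigD1 i) //= linearZ /= (coord_delta hX) eqxx mulr1.
rewrite big1 ?addr0 // => j ji; rewrite linearZ /= (coord_delta hX).
by rewrite eq_sym (negPf ji) mulr0.
Qed.

Lemma lift_vec_int u : val_ge v 0 (lift_vec u).
Proof. by rewrite X_int; apply/forallP => i; rewrite coord_lift_vec lift_int. Qed.

Lemma lift_vec_close x : val_ge v 0 x ->
  val_gt v 0 (x - lift_vec (fun i => r (coord X i x))).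
Proof.
move=> xO; apply: gt_coord => i; rewrite linearB /= coord_lift_vec.
by rewrite -(res_eq hvK hr) ?coord_int ?lift_int // liftK.
Qed.

Lemma top_residue_field : exists (l : finFieldType) (rl : L -> l), residue_morphism v rl.
Proof.
apply: (residue_field (S := codom (fun u : {ffun 'I_n -> k} => lift_vec u))) => // x xO.
exists (lift_vec [ffun i => r (coord X i x)]); first exact: codom_f.
have -> : lift_vec [ffun i => r (coord X i x)] = lift_vec (fun i => r (coord X i x)).
  by apply: eq_bigr => i _; rewrite ffunE.
exact: lift_vec_close.
Qed.

(** * Frobenius and the Moore matrix over the residue field of L *)

Section TopResidue.
Variables (l : finFieldType) (rl : L -> l).
Hypothesis hrl : residue_morphism v rl.
Local Notation q := #|k|.
Local Notation Fr a y := (y ^+ (q ^ a)).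

Lemma card_pnat : [pchar l].-nat q.
Proof.
have [p p_prime pk] := finPcharP k.
have pl : p \in [pchar l].
  rewrite inE p_prime -(res_nat hv hrl p).2 (res_eq0 hrl) ?(res_nat hv hrl p).1 //.
  rewrite -(rmorph_nat (in_alg L)) /= alg_gt -(res_eq0 hr) ?(res_nat hvK hr p).1 //.
  by rewrite (res_nat hvK hr p).2; rewrite inE in pk; case/andP: pk.
rewrite (eq_pnat _ (pcharf_eq pl)) (card_pprimeChar pk).
by rewrite pnatX pnat_id.
Qed.

Lemma FrD a (x y : l) : Fr a (x + y) = Fr a x + Fr a y.
Proof. by rewrite exprDn_pchar // pnatX card_pnat. Qed.

Lemma Fr_sum a (I : finType) (f : I -> l) : Fr a (\sum_i f i) = \sum_i Fr a (f i).
Proof.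
apply: (big_morph (fun y => Fr a y)); first exact: FrD.
by rewrite expr0n expn_eq0 eqn0Ngt (ltnW (finNzRing_gt1 k)).
Qed.

Lemma Fr_alg a b : val_ge vK 0 b -> Fr a (rl b%:A) = rl b%:A.
Proof.
move=> bO; have bLO : val_ge v 0 (b%:A : L) by rewrite alg_ge.
have Fr1 : rl b%:A ^+ q = rl b%:A.
  rewrite -(resX hv hrl) //; apply/eqP; rewrite (res_eq hv hrl) ?val_ge0X //.
  rewrite -[_ ^+ q](rmorphXn (in_alg L)) -rmorphB /= alg_gt.
  by rewrite -(res_eq hvK hr) ?val_ge0X // (resX hvK hr) // expf_card.
by elim: a => [|a IHa]; rewrite ?expr1 // expnS exprM Fr1.
Qed.

(** Powers of the q-Frobenius are additive and fix the image of the residue field of [K], hence are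
    linear over it. *)
Lemma Fr_expand a x : val_ge v 0 x ->
  Fr a (rl x) = \sum_i rl (coord X i x)%:A * Fr a (rl X`_i).
Proof.
move=> xO; rewrite {1}(coordE hX x) (res_sum hv hrl) => [|i _]; last first.
  by apply: scale_int; rewrite ?basis_int ?coord_int.
rewrite Fr_sum; apply: eq_bigr => i _; rewrite -[_ *: X`_i]mulr_algl.
by rewrite (resM hrl) ?alg_ge ?coord_int ?basis_int // exprMn Fr_alg ?coord_int.
Qed.

Lemma card_top : (q ^ n <= #|l|)%N.
Proof.
rewrite -{1}(card_ord n) -card_ffun.
apply: (leq_card (fun u : {ffun 'I_n -> k} => rl (lift_vec u))) => u w /eqP.
rewrite (res_eq hv hrl) ?lift_vec_int // => /coord_gt h; apply/ffunP => i.
move: (h i); rewrite linearB /= !coord_lift_vec -(res_eq hvK hr) ?lift_int //.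
by rewrite !liftK => /eqP.
Qed.

(* The Moore matrix of the reduced basis is invertible: a linear relation between
   its rows is a polynomial of degree at most q^(n-1) vanishing on all of l. *)
Lemma moore_inj (s : 'I_n -> l) :
  (forall a, \sum_j s j * Fr a (rl X`_j) = 0) -> forall j, s j = 0.
Proof.
move=> hs; pose M : 'M[l]_n := \matrix_(a, j) Fr a (rl X`_j).
suff detM : \det M != 0.
  have : M^T \in unitmx by rewrite unitmxE det_tr unitfE.
  rewrite -row_free_unit => fM j.
  have : (\row_j s j) *m M^T == 0.
    apply/eqP/rowP => a; rewrite !mxE -[RHS](hs a); apply: eq_bigr => i _.
    by rewrite !mxE.
  by rewrite mulmx_free_eq0 // => /eqP/rowP/(_ j); rewrite !mxE.
apply/det0P => -[u u0 uM].
have [a ua] : exists a, u 0 a != 0.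
  apply/existsP; apply: contraR u0; rewrite negb_exists => /forallP h.
  by apply/eqP/rowP => a; move: (h a); rewrite negbK mxE => /eqP.
pose P : {poly l} := \sum_a u 0 a *: 'X^(q ^ a).
have q1 : (1 < q)%N := finNzRing_gt1 k.
have P0 : P != 0.
  apply: contraNneq ua => /(congr1 (fun p : {poly l} => p`_(q ^ a))).
  rewrite coef0 coef_sum (bigD1 a) //= coefZ coefXn eqxx mulr1 big1 ?addr0 => [->//|b ba].
  by rewrite coefZ coefXn eqn_exp2l // eq_sym (inj_eq val_inj) (negPf ba) mulr0.
have Pr y : root P y.
  have [x xO <-] := res_onto hrl y; rewrite /root /P horner_sum.
  under eq_bigr => b _ do rewrite hornerZ hornerXn Fr_expand // mulr_sumr.
  rewrite exchange_big big1 // => j _ /=.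
  transitivity (rl (coord X j x)%:A * (u *m M) 0 j); last by rewrite uM mxE mulr0.
  by rewrite mxE mulr_sumr; apply: eq_bigr => b _; rewrite mxE mulrCA.
have := max_poly_roots P0 (rs := enum l) _ (enum_uniq l).
rewrite -cardE => /(_ (introT allP (fun y _ => Pr y))).
apply/negP; rewrite -leqNgt; apply: leq_trans card_top.
apply: (leq_trans (size_sum _ _ _)); apply/bigmax_leqP => b _.
apply: leq_trans (size_scale_leq _ _) _; rewrite size_polyXn.
by rewrite ltn_exp2l.
Qed.

End TopResidue.

(** * Integrality of the coordinate operators *)

Section HopfOrder.
Variables (H : falgType K) (hs : hopf_structure H) (act : {linear H -> 'End(L)}).
Hypothesis hHG : hopf_galois hs act.
Local Notation A := (associated_order act (valuation_ring v)).

Lemma order_scale a h : val_ge vK 0 a -> A h -> A (a *: h).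
Proof.
move=> aO hA x xO; rewrite linearZ scale_lfunE.
by apply: scale_int => //; apply: hA.
Qed.

Lemma order_sum (I : finType) (h : I -> H) : (forall i, A (h i)) -> A (\sum_i h i).
Proof.
move=> hA x xO; rewrite linear_sum sum_lfunE.
by apply: (val_ge_sum hv) => i _; apply: hA.
Qed.

Lemma int_of_basis (f : 'End(L)) :
  (forall i : 'I_n, val_ge v 0 (f X`_i)) -> forall x, val_ge v 0 x -> val_ge v 0 (f x).
Proof.
move=> hf x xO; rewrite (coordE hX x) linear_sum; apply: (val_ge_sum hv) => i _.
by rewrite linearZZ; apply: scale_int; [apply: coord_int | apply: hf].
Qed.

Lemma clear_denominator x : exists d0 : nat, forall d, (d0 <= d)%N ->
  val_ge v 0 (t ^+ d *: x).
Proof.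
have [-> | x0] := eqVneq x 0; first by exists 0%N => d _; rewrite scaler0 val_ge0.
have [N hN] := rat_le_nat (- v x / v t%:A).
exists N => d Nd; rewrite -mulr_algl.
have -> : (t ^+ d)%:A = t%:A ^+ d :> L by exact: (rmorphXn (in_alg L)).
rewrite val_geE ?mulf_neq0 ?expf_neq0 // (valuationM hv) ?expf_neq0 //.
rewrite (valuationX hv) // -lerBlDr sub0r -[v _ *+ d]mulr_natl -ler_pdivrMr //.
by apply: le_trans hN _; rewrite ler_nat.
Qed.

Section DualBasisIntegral.
Variable hh : 'I_n -> 'I_n -> H.
Hypothesis hhE : forall j x,
  (coord X j x)%:A = \sum_(m < n) X`_m * act (hh j m) x :> L.

Lemma dual_denominators : exists d, forall j m, A (t ^+ d *: hh j m).
Proof.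
have /choice[d0 hd] : forall s : 'I_n * 'I_n * 'I_n, exists d0 : nat, forall d,
    (d0 <= d)%N -> val_ge v 0 (t ^+ d *: act (hh s.1.1 s.1.2) X`_s.2).
  by move=> s; apply: clear_denominator.
exists (\max_s d0 s) => j m; apply: int_of_basis => i.
by rewrite linearZ scale_lfunE; apply: (hd (j, m, i)); apply: leq_bigmax.
Qed.

(* Theta x = sum w_m (x) w_j (x) h_jm x is multiplicative; if d+1 powers of t clear
   the denominators, then t^(d+1) Theta x squares to 0 in the reduced ring
   l (x) l (x) l, so it vanishes there and d powers suffice. *)
Lemma dual_denominators_step d :
  (forall j m, A (t ^+ d.+1 *: hh j m)) -> forall j m, A (t ^+ d *: hh j m).
Proof.
move=> hd; have [l [rl hrl]] := top_residue_field.
pose u := t ^+ d.+1; pose g j m := act (u *: hh j m).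
have gE j m x : g j m x = u *: act (hh j m) x by rewrite /g linearZ scale_lfunE.
have gO j m x : val_ge v 0 x -> val_ge v 0 (g j m x) by apply: hd.
have uO : val_ge vK 0 u by apply/val_ge0X/val_gt_ge/t_gt; exact: hvK.
have ru : rl u%:A = 0.
  apply/eqP; rewrite (res_eq0 hrl) ?alg_ge // alg_gt /u exprSr.
  by apply: (val_gtM hvK); rewrite ?t_gt // val_ge0X // val_gt_ge // t_gt.
(* The image in [l] of t^(d+1) Theta x under the map from l (x) l (x) l that applies Frobenius
   powers a and b to the last two factors and multiplies. *)
pose Ev a b x := \sum_(s : 'I_n * 'I_n)
  rl X`_s.2 * rl X`_s.1 ^+ (#|k| ^ a) * rl (g s.1 s.2 x) ^+ (#|k| ^ b).
have coefs (I : finType) (x y z : I -> L) a b :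
    (forall s, val_ge v 0 (x s)) -> (forall s, val_ge v 0 (y s)) ->
    (forall s, val_ge v 0 (z s)) ->
  \sum_s rl (x s) * rl (y s) ^+ (#|k| ^ a) * rl (z s) ^+ (#|k| ^ b) =
  \sum_i \sum_j rl (\sum_s x s * (coord X i (y s))%:A * (coord X j (z s))%:A) *
     rl X`_i ^+ (#|k| ^ a) * rl X`_j ^+ (#|k| ^ b).
  move=> xO yO zO.
  transitivity (\sum_s \sum_i \sum_j rl (x s * (coord X i (y s))%:A *
     (coord X j (z s))%:A) * rl X`_i ^+ (#|k| ^ a) * rl X`_j ^+ (#|k| ^ b)).
    apply: eq_bigr => s _; rewrite !(Fr_expand hrl) // -mulrA mulr_suml mulr_sumr.
    apply: eq_bigr => i _; rewrite !mulr_sumr; apply: eq_bigr => j _.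
    by rewrite !(resM hrl) ?(val_ge0M hv) ?alg_ge ?coord_int //; ring.
  rewrite exchange_big; apply: eq_bigr => i _; rewrite exchange_big.
  apply: eq_bigr => j _; rewrite (res_sum hv hrl) ?mulr_suml //= => s _.
  by rewrite !(val_ge0M hv) ?alg_ge ?coord_int.
have Ev0 a b x : val_ge v 0 x -> Ev a b x = 0.
  (* As [l] is a field, the square may be shown to vanish. By multiplicativity it comes from t^(d+1)
     times t^(d+1) Theta(x^2), and the extra factor [u] reduces to 0. *)
  move=> xO; apply/eqP; rewrite -[_ == 0]orbb -mulf_eq0; apply/eqP.
  rewrite /Ev big_distrlr /= pair_bigA /=.
  transitivity (\sum_(s : 'I_n * 'I_n * ('I_n * 'I_n)) rl (X`_s.1.2 * X`_s.2.2) *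
    rl (X`_s.1.1 * X`_s.2.1) ^+ (#|k| ^ a) *
    rl (g s.1.1 s.1.2 x * g s.2.1 s.2.2 x) ^+ (#|k| ^ b)).
    apply: eq_bigr => s _; rewrite !(resM hrl) ?basis_int ?gO //.
    by rewrite !exprMn; ring.
  rewrite coefs => [|s|s|s]; try by rewrite (val_ge0M hv) ?basis_int ?gO.
  transitivity (\sum_(s : 'I_n * 'I_n) rl (u%:A * X`_s.2) *
      rl X`_s.1 ^+ (#|k| ^ a) * rl (g s.1 s.2 (x * x)) ^+ (#|k| ^ b)).
    rewrite coefs => [|s|s|s]; try by
      rewrite ?(val_ge0M hv) ?alg_ge ?basis_int ?gO ?(val_ge0M hv).
    apply: eq_bigr => i _; apply: eq_bigr => j _; congr (rl _ * _ * _).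
    apply: (tensor_coords hhE) => h h'.
    transitivity ((u * u) *: act h' (act h (x * x))).
      rewrite -(expansion_mul hHG hX hhE) pair_bigA scaler_sumr.
      apply: eq_bigr => s _ /=.
      by rewrite !gE -scalerAl -scalerAr scalerA linearZZ -scalerAr.
    rewrite (act_expansion hHG hX hhE) scaler_sumr; apply: eq_bigr => s _.
    by rewrite gE linearZZ mulr_algl -!scalerAl -!scalerAr scalerA.
  apply: big1 => s _; rewrite (resM hrl) ?alg_ge ?basis_int // ru.
  by rewrite !mul0r.
(* [moore_inj] is used once per tensor factor: [step1] removes the third, [step2] the second, and
   the last use removes the first. *)
have rg0 j m x : val_ge v 0 x -> rl (g j m x) = 0.
  move=> xO.
  have z0 i j' m' : rl (coord X i (g j' m' x))%:A = 0.
    have step1 i' a : \sum_(s : 'I_n * 'I_n) rl X`_s.2 * rl X`_s.1 ^+ (#|k| ^ a) *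
        rl (coord X i' (g s.1 s.2 x))%:A = 0.
      move: i'; apply: (moore_inj hrl) => b; rewrite -[RHS](Ev0 a b x xO).
      under eq_bigr => i' _ do rewrite mulr_suml.
      rewrite exchange_big; apply: eq_bigr => s _ /=.
      rewrite (Fr_expand hrl b (gO s.1 s.2 x xO)) mulr_sumr.
      by apply: eq_bigr => i' _; rewrite mulrA.
    have step2 i' j1 : \sum_(m1 < n) rl X`_m1 * rl (coord X i' (g j1 m1 x))%:A = 0.
      move: j1; apply: (moore_inj hrl) => a; rewrite -[RHS](step1 i' a).
      rewrite -(pair_bigA _ (fun j1 m1 : 'I_n => rl X`_m1 * rl X`_j1 ^+ (#|k| ^ a) *
        rl (coord X i' (g j1 m1 x))%:A)) /=.
      apply: eq_bigr => j1 _; rewrite mulr_suml; apply: eq_bigr => m1 _; ring.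
    pose s m1 := rl (coord X i (g j' m1 x))%:A; rewrite -/(s m').
    move: m'; apply: (moore_inj hrl) => a.
    (* The [s m1] come from [K] and are fixed by Frobenius, so powers of the relation in [step2]
       supply all those needed by [moore_inj]. *)
    transitivity ((\sum_(m1 < n) rl X`_m1 * s m1) ^+ (#|k| ^ a)); last first.
      by rewrite step2 expr0n expn_eq0 eqn0Ngt (ltnW (finNzRing_gt1 k)).
    rewrite (Fr_sum hrl); apply: eq_bigr => m1 _; rewrite exprMn mulrC.
    by rewrite (Fr_alg hrl) ?coord_int ?gO.
  have := Fr_expand hrl 0 (gO j m x xO); rewrite expn0 expr1 => ->.
  by rewrite big1 // => i _; rewrite z0 mul0r.
move=> j m x xO; have /eqP := rg0 j m x xO.
rewrite (res_eq0 hrl) ?gO // => /gt0_mult[y yO].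
rewrite gE /u exprS -scalerA => /(scalerI t0) e.
by rewrite linearZ scale_lfunE e.
Qed.

Lemma dual_order j m : A (hh j m).
Proof.
have [d hd] := dual_denominators; elim: d hd => [|d IHd] hd.
  by have := hd j m; rewrite expr0 scale1r.
exact/IHd/dual_denominators_step.
Qed.

End DualBasisIntegral.

(** f is the sum of the f(w_j) E_j, where E_j is the sum of the w_m h_jm with h_jm in the order by
    [dual_order]; the coefficients f(w_j) w_m are then expanded in the basis. *)
Lemma galois_onto_order (f : 'End(L)) : (forall x, val_ge v 0 x -> val_ge v 0 (f x)) ->
  exists2 h : 'I_n -> H, forall i, A (h i) &
    forall x, f x = \sum_(i < n) X`_i * act (h i) x.
Proof.
move=> fO.
have /choice[hh hhE] : forall j : 'I_n, exists h : 'I_n -> H, forall x,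
    (coord X j x)%:A = \sum_(m < n) X`_m * act (h m) x.
  move=> j; have lin : linear (fun x => (coord X j x)%:A : L).
    by move=> a x y; rewrite linearP scalerDl scalerA.
  pose g : {linear L -> L} := HB.pack (fun x => (coord X j x)%:A : L)
    (GRing.isLinear.Build _ _ _ _ _ lin).
  have [h hE] := galois_onto hHG hX (linfun g).
  by exists h => x; rewrite -hE lfunE.
exists (fun i : 'I_n => \sum_(j < n) \sum_(m < n)
          coord X i (f X`_j * X`_m) *: hh j m) => [i|x].
  apply: order_sum => j; apply: order_sum => m; apply: order_scale.
    by apply: coord_int; rewrite (val_ge0M hv) ?fO ?basis_int.
  exact: (dual_order hhE).
rewrite {1}(coordE hX x) linear_sum.
under eq_bigr => j _ do rewrite linearZZ -mulr_algl hhE mulr_suml.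
under [RHS]eq_bigr => i _.
  rewrite linear_sum sum_lfunE mulr_sumr.
  under eq_bigr => j _.
    rewrite linear_sum sum_lfunE mulr_sumr.
    under eq_bigr => m _ do rewrite linearZ scale_lfunE -scalerAr scalerAl.
    over.
  over.
rewrite [RHS]exchange_big; apply: eq_bigr => j _ /=.
rewrite [RHS]exchange_big; apply: eq_bigr => m _ /=.
rewrite -mulr_suml -(coordE hX); ring.
Qed.

Hypothesis unr : forall x : L, x != 0 -> exists2 a : K, a != 0 & v x = v a%:A.
Hypothesis char0 : forall m, (m.+1)%:R != 0 :> K.

(* The trace form, rescaled to be surjective onto the integers of K, is perfect on
   the integers of L, and the antipode is the adjunction for it. *)
Lemma invariant_form : exists lam : {linear L -> K^o},
  [/\ forall x, val_ge v 0 x -> val_ge vK 0 (lam x),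
      exists2 w, val_ge v 0 w & lam w = 1 &
      forall h x y, lam (act h x * y) = lam (x * act (antipode hs h) y)].
Proof.
pose tr : {linear L -> K^o} := HB.pack (ftrace X : L -> K^o)
  (GRing.isLinear.Build _ _ _ _ (ftrace X : L -> K^o) (ftrace_linear X)).
(* The trace is not identically zero: the trace of 1 is n, nonzero in characteristic 0. *)
have [i0 ti0] : exists i : 'I_n, tr X`_i != 0.
  apply/existsP; apply: contraT; rewrite negb_exists => /forallP h.
  have : tr 1 = 0.
    rewrite (coordE hX 1) linear_sum big1 // => i _.
    by move: (h i); rewrite negbK linearZZ => /eqP->; rewrite scaler0.
  have n0 : (0 < n)%N.
    have -> : n = \dim {:L} by rewrite -(span_basis hX) (eqP (basis_free hX)) size_tuple.
    exact: adim_gt0.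
  by rewrite /= (ftrace1 hX) -(prednK n0) => /eqP; rewrite (negPf (char0 _)).
(* Dividing by a trace of least valuation among the basis vectors keeps the form integral and gives
   it the value 1 at that vector. *)
have [j [tj _ trO]] := val_normalize hvK (c := fun i : 'I_n => tr X`_i) ti0.
have lin : linear (fun x => tr x / tr X`_j : K^o).
  by move=> a x y; rewrite linearP mulrDl -mulrA.
pose lam : {linear L -> K^o} := HB.pack (fun x => tr x / tr X`_j : K^o)
  (GRing.isLinear.Build _ _ _ _ _ lin).
exists lam; split=> [x xO||h x y].
- rewrite (coordE hX x) linear_sum; apply: (val_ge_sum hvK) => i _.
  by rewrite linearZZ; apply: (val_ge0M hvK); [apply: coord_int | apply: trO].
- by exists X`_j; [exact: basis_int | rewrite /= mulfV].
- by rewrite /= (ftrace_adjoint hHG hX).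
Qed.

(** * The perfect invariant form and adjoints *)

Section Form.
Variable lam : {linear L -> K^o}.
Hypothesis lam_int : forall x, val_ge v 0 x -> val_ge vK 0 (lam x).
Hypothesis lam_onto : exists2 w, val_ge v 0 w & lam w = 1.
Hypothesis lam_adj : forall h x y,
  lam (act h x * y) = lam (x * act (antipode hs h) y).

Lemma form_nondeg x : (forall y, lam (x * y) = 0) -> x = 0.
Proof.
move=> h; apply/eqP/negPn/negP => x0; have [w _ lw] := lam_onto.
have := h (x^-1 * w); rewrite mulVKf // lw => /eqP.
by rewrite oner_eq0.
Qed.

(** As L/K is unramified, [z] has the valuation of some [a] in [K], so a / z is a unit. Testing
    against w (a / z) returns [a], which is therefore integral. *)
Lemma form_perfect z :
  (forall x, val_ge v 0 x -> val_ge vK 0 (lam (x * z))) -> val_ge v 0 z.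
Proof.
move=> h; apply/negPn/negP => nz.
have z0 : z != 0 by apply: contraNneq nz => ->; rewrite val_ge0.
have [a a0 va] := unr z0; have [w wO lw] := lam_onto.
have aL0 : a%:A != 0 :> L by rewrite scaler_eq0 oner_eq0 orbF.
have e : lam (w * (a%:A / z) * z) = a.
  by rewrite -mulrA divfK // mulrC mulr_algl linearZZ lw; apply: mulr1.
move: nz; rewrite val_geE // va -val_geE // alg_ge => /negP; apply.
rewrite -e; apply: h; apply: (val_ge0M hv) => //.
rewrite val_geE ?mulf_neq0 ?invr_eq0 // (valuationM hv) ?invr_eq0 //.
by rewrite (valuationV hv) // va subrr.
Qed.

Lemma antipode_order h : A h -> A (antipode hs h).
Proof.
move=> hA y yO; apply: form_perfect => x xO; rewrite -lam_adj.
by apply: lam_int; apply: (val_ge0M hv) => //; apply: hA.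
Qed.

(** [galois_onto_order] is applied to the adjoint [fd] of [f], built from the basis [Xd] dual to
    [X]. The adjoint of y |-> w_i h_i(y) is x |-> S(h_i)(w_i x), and S preserves the order. *)
Lemma galois_onto_order_right (f : 'End(L)) :
  (forall x, val_ge v 0 x -> val_ge v 0 (f x)) ->
  exists2 h : 'I_n -> H, forall i, A (h i) &
    forall x, f x = \sum_(i < n) act (h i) (X`_i * x).
Proof.
move=> fO.
pose G : 'M[K]_n := \matrix_(i, j) lam (X`_i * X`_j).
have detG : \det G != 0.
  apply/det0P => -[u u0 uG]; pose x := \sum_(i < n) u 0 i *: X`_i.
  have x0 : x = 0.
    apply: form_nondeg => y; rewrite (coordE hX y) mulr_sumr linear_sum big1 // => j _.
    have xj0 : lam (x * X`_j) = \sum_i u 0 i * G i j.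
      rewrite /x mulr_suml linear_sum; apply: eq_bigr => i _.
      by rewrite -scalerAl linearZZ mxE.
    have uGj : \sum_i u 0 i * G i j = 0 by move/rowP/(_ j): uG; rewrite !mxE.
    by rewrite -scalerAr linearZZ xj0 uGj scaler0.
  move/negP: u0; apply; apply/eqP/rowP => i; rewrite mxE.
  have /freeP fX := basis_free hX; exact: (fX (fun i => u 0 i) x0).
have uG : G \in unitmx by rewrite unitmxE unitfE.
pose Xd j := \sum_(m < n) invmx G m j *: X`_m.
have XdE (i j : 'I_n) : lam (X`_i * Xd j) = (i == j)%:R.
  have := mulmxV uG => /matrixP/(_ i j); rewrite !mxE => <-.
  rewrite /Xd mulr_sumr linear_sum; apply: eq_bigr => m _.
  by rewrite -scalerAr linearZZ ?mxE [RHS]mulrC.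
have lin : linear (fun y => \sum_(i < n) lam (f X`_i * y) *: Xd i).
  move=> a x y; rewrite scaler_sumr -big_split; apply: eq_bigr => i _ /=.
  by rewrite mulrDr -scalerAr linearP scalerDl -scalerA.
pose fdL : {linear L -> L} := HB.pack (fun y => \sum_(i < n) lam (f X`_i * y) *: Xd i)
  (GRing.isLinear.Build _ _ _ _ _ lin).
pose fd := linfun fdL.
have fdE x y : lam (x * fd y) = lam (f x * y).
  rewrite lfunE /= mulr_sumr [f x](_ : _ = \sum_(i < n) coord X i x *: f X`_i).
    rewrite mulr_suml !linear_sum; apply: eq_bigr => i _.
    rewrite -scalerAr -scalerAl !linearZZ {1}(coordE hX x) mulr_suml linear_sum.
    rewrite (bigD1 i) //= -scalerAl linearZZ XdE eqxx big1 ?addr0 => [|m mi].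
      by rewrite -![_ *: _]/(_ * _) mulr1 mulrC.
    by rewrite -scalerAl linearZZ XdE (negPf mi) scaler0.
  by rewrite {1}(coordE hX x) linear_sum; apply: eq_bigr => i _; rewrite linearZZ.
have fdO y : val_ge v 0 y -> val_ge v 0 (fd y).
  move=> yO; apply: form_perfect => x xO; rewrite fdE; apply: lam_int.
  by apply: (val_ge0M hv) => //; apply: fO.
have [h hA hE] := galois_onto_order fdO.
exists (fun i => antipode hs (h i)) => [i|x]; first exact: antipode_order.
apply/eqP; rewrite -subr_eq0; apply/eqP; apply: form_nondeg => y.
rewrite mulrBl linearB /= -fdE hE mulr_sumr linear_sum mulr_suml linear_sum.
rewrite -sumrB big1 // => i _.
rewrite [X in _ - lam X]mulrC -lam_adj mulrA [act _ _ * _]mulrC [x * _]mulrC.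
by rewrite subrr.
Qed.

End Form.

(** * Reduction of the associated order modulo the uniformizer *)

Definition red_vec (x : L) : 'rV[k]_n := \row_j r (coord X j x).
(** Matrices act on row vectors from the right, so [red_mxM] reverses products. *)
Definition red_mx (f : 'End(L)) : 'M[k]_n := \matrix_(i, j) r (coord X j (f X`_i)).
Local Notation stable f := (forall x, val_ge v 0 x -> val_ge v 0 (f x)).

Lemma red_vecE (f : 'End(L)) x : stable f -> val_ge v 0 x ->
  red_vec (f x) = red_vec x *m red_mx f.
Proof.
move=> fO xO; apply/rowP => j; rewrite !mxE {1}(coordE hX x) !linear_sum.
rewrite (eq_bigr (fun i => coord X i x * coord X j (f X`_i))) => [|i _]; last first.
  by rewrite linearZZ linearZ.
rewrite (res_sum hvK hr) => [|i _]; last first.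
  by rewrite (val_ge0M hvK) ?coord_int ?fO ?basis_int.
by apply: eq_bigr => i _; rewrite !mxE (resM hr) ?coord_int ?fO ?basis_int.
Qed.

Lemma red_vecZ a x : val_ge vK 0 a -> val_ge v 0 x ->
  red_vec (a *: x) = r a *: red_vec x.
Proof.
by move=> aO xO; apply/rowP => j; rewrite !mxE linearZ /= (resM hr) ?coord_int.
Qed.

Lemma red_vec_sum (I : finType) (x : I -> L) : (forall i, val_ge v 0 (x i)) ->
  red_vec (\sum_i x i) = \sum_i red_vec (x i).
Proof.
move=> xO; apply/rowP => j; rewrite summxE mxE linear_sum (res_sum hvK hr).
  by apply: eq_bigr => i _; rewrite mxE.
by move=> i _; apply: coord_int.
Qed.

Lemma red_vec_eq0 x : val_ge v 0 x -> (red_vec x == 0) = val_gt v 0 x.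
Proof.
move=> xO; apply/eqP/idP => [/rowP h|xm].
  apply: gt_coord => i; rewrite -(res_eq0 hr) ?coord_int //.
  by move: (h i); rewrite !mxE => ->.
by apply/rowP => i; rewrite !mxE; apply/eqP; rewrite (res_eq0 hr) ?coord_int ?coord_gt.
Qed.

Lemma red_vec_lift (u : 'rV[k]_n) : red_vec (lift_vec (fun i => u 0 i)) = u.
Proof. by apply/rowP => i; rewrite mxE coord_lift_vec liftK. Qed.

Lemma red_vec_basis (i : 'I_n) : red_vec X`_i = delta_mx 0 i.
Proof.
apply/rowP => j; rewrite !mxE (coord_delta hX) eqxx eq_sym /=.
by case: eqP => _; rewrite ?(res1 hr) ?(res0 hr).
Qed.

Lemma row_red_mx (f : 'End(L)) (i : 'I_n) : row i (red_mx f) = red_vec (f X`_i).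
Proof. by apply/rowP => j; rewrite !mxE. Qed.

Lemma red_mx_comb (I : finType) (c : I -> K) (h : I -> H) :
  (forall i, val_ge vK 0 (c i)) -> (forall i, A (h i)) ->
  red_mx (act (\sum_i c i *: h i)) = \sum_i r (c i) *: red_mx (act (h i)).
Proof.
move=> cO hA; apply/row_matrixP => j; rewrite row_red_mx linear_sum sum_lfunE.
rewrite red_vec_sum => [|i]; last by apply: order_scale => //; apply: basis_int.
rewrite raddf_sum; apply: eq_bigr => i _ /=.
rewrite linearZ scale_lfunE red_vecZ //; last by apply: hA; apply: basis_int.
by apply/rowP => b; rewrite !mxE.
Qed.

Lemma red_mxM h h' : A h -> A h' ->
  red_mx (act (h * h')) = red_mx (act h') *m red_mx (act h).
Proof.
move=> hA hA'; apply/row_matrixP => j; rewrite row_red_mx row_mul row_red_mx.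
rewrite -red_vecE //; last by apply: hA'; apply: basis_int.
by have [[_ -> _ _] _] := hHG; rewrite comp_lfunE.
Qed.

Lemma red_mx1 : red_mx (act 1) = 1%:M.
Proof.
apply/row_matrixP => j; rewrite row_red_mx row1.
by have [[-> _ _ _] _] := hHG; rewrite id_lfunE red_vec_basis.
Qed.

(** A relation between the [h i], normalized to integral coefficients one of which is 1, would
    reduce to a nontrivial relation; so the [h i] are free in [H]. *)
Lemma red_mx_free (m : nat) (h : 'I_m -> H) : (forall i, A (h i)) ->
  (forall c : 'I_m -> k, \sum_i c i *: red_mx (act (h i)) = 0 -> forall i, c i = 0) ->
  (m <= n)%N.
Proof.
move=> hA hfree; apply: leq_trans (dim_hopf_le hHG hX).
pose T := [tuple h i | i < m].
have TE (i : 'I_m) : T`_i = h i by rewrite -tnth_nth tnth_mktuple.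
suff fT : free T by rewrite -[m](size_tuple T) -(eqP fT : \dim <<T>> = _) dimvS // subvf.
apply/freeP => c hc i0; apply/eqP/negPn/negP => ci0.
have [j [cj _ cO]] := val_normalize hvK ci0.
have := red_mx_comb cO hA; set s := \sum_i _ *: h i.
have -> : s = 0.
  transitivity ((c j)^-1 *: \sum_(i < m) c i *: T`_i); last by rewrite hc scaler0.
  by rewrite scaler_sumr; apply: eq_bigr => i _; rewrite TE scalerA mulrC.
move=> e; have red0 : red_mx (act 0) = 0.
  apply/matrixP => a b; rewrite !mxE linear0 zero_lfunE linear0.
  exact: (res0 hr).
have := hfree (fun i => r (c i / c j)) (etrans (esym e) red0) j.
by rewrite mulfV // (res1 hr) => /eqP; rewrite oner_eq0.
Qed.

Definition red_order : {set 'M[k]_n} :=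
  [set M | `[< exists2 h, A h & red_mx (act h) = M >]].

Lemma red_orderP M : reflect (exists2 h, A h & red_mx (act h) = M) (M \in red_order).
Proof. by rewrite inE; apply: asboolP. Qed.

Lemma red_order_comb (I : finType) (c : I -> k) (M : I -> 'M[k]_n) :
  (forall i, M i \in red_order) -> \sum_i c i *: M i \in red_order.
Proof.
move=> hM; have /choice[h hh] : forall i, exists h, A h /\ red_mx (act h) = M i.
  by move=> i; have /red_orderP[h] := hM i; exists h.
apply/red_orderP; exists (\sum_i lift (c i) *: h i).
  by apply: order_sum => i; apply: order_scale; [exact: lift_int | case: (hh i)].
rewrite red_mx_comb => [|i|i]; try by [exact: lift_int | case: (hh i)].
by apply: eq_bigr => i _; rewrite liftK; case: (hh i) => _ ->.
Qed.

(** The reduced order is a subspace over [k], and a basis of it lifts to a free family in [H]. *)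
Lemma card_red_order : (#|red_order| <= #|k| ^ n)%N.
Proof.
pose U := <<enum red_order>>%VS; pose b := vbasis U; pose m := \dim U.
have red_sub M : M \in red_order -> M \in U.
  by move=> hM; apply: memv_span; rewrite mem_enum.
have sub_red M : M \in U -> M \in red_order.
  move/(@coord_span _ _ _ (in_tuple (enum red_order))) => ->.
  by apply: red_order_comb => i; rewrite -mem_enum; apply: mem_nth.
have bB (i : 'I_m) : b`_i \in red_order.
  by apply: sub_red; apply: vbasis_mem; apply: mem_nth; rewrite size_tuple.
have /choice[h hh] : forall i : 'I_m, exists h, A h /\ red_mx (act h) = b`_i.
  by move=> i; have /red_orderP[h] := bB i; exists h.
have mn : (m <= n)%N.
  apply: (@red_mx_free m h) => [i|c hc]; first by case: (hh i).
  have /freeP := basis_free (vbasisP U); apply; rewrite -[RHS]hc.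
  by apply: eq_bigr => i _; case: (hh i) => _ ->.
pose g (c : {ffun 'I_m -> k}) := \sum_i c i *: b`_i.
apply: (@leq_trans #|[set g c | c in {ffun 'I_m -> k}]|).
  apply/subset_leq_card/subsetP => M /red_sub MU; apply/imsetP.
  exists [ffun i => coord b i M] => //; rewrite {1}(coord_vbasis MU).
  by apply: eq_bigr => i _; rewrite ffunE.
apply: leq_trans (leq_imset_card _ _) _; rewrite card_ffun card_ord.
by rewrite leq_pexp2l // ltnW // finNzRing_gt1.
Qed.

(** [x] lifts a generator found by [finite_cyclic]. Elements [a i] of the order send [x] to vectors
    congruent to the basis, which form an integral basis again; the [a i] are then a basis of
    [H]. *)
Lemma order_cyclic : exists x, [/\ val_ge v 0 x,
  forall y, val_ge v 0 y -> exists2 h, A h & y = act h x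
  & forall h, act h x = 0 -> h = 0].
Proof.
have [lam [lam_int lam_onto lam_adj]] := invariant_form.
pose mul i : 'End(L) := linfun (X`_i \*o idfun).
have mulE i y : mul i y = X`_i * y by rewrite lfunE.
have mulO i : stable (mul i).
  by move=> y yO; rewrite mulE; apply: (val_ge0M hv); rewrite ?basis_int.
have scal c : c%:M \in red_order.
  (* A sum over one index, so that [red_mx_comb] applies. *)
  apply/red_orderP; exists (\sum_(i < 1) lift c *: 1).
    apply: order_sum => _; apply: order_scale; first exact: lift_int.
    by have [[a1 _ _ _] _] := hHG; move=> y yO; rewrite a1 id_lfunE.
  rewrite red_mx_comb => [|_|_]; first 1 last.
  - exact: lift_int.
  - by have [[a1 _ _ _] _] := hHG; move=> y yO; rewrite a1 id_lfunE.
  by rewrite big_ord1 red_mx1 liftK scale_scalar_mx mulr1.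
have add M N : M \in red_order -> N \in red_order -> M + N \in red_order.
  move=> hM hN; pose F (b : bool) := if b then M else N.
  have := @red_order_comb bool (fun _ => 1) F.
  by rewrite big_bool !scale1r; apply => -[].
have mulB M N : M \in red_order -> N \in red_order -> M *m N \in red_order.
  move=> /red_orderP[h hA <-] /red_orderP[h' hA' <-]; rewrite -red_mxM //.
  apply/red_orderP; exists (h' * h) => // y yO.
  by have [[_ -> _ _] _] := hHG; rewrite comp_lfunE; apply: hA'; apply: hA.
(* [F] is lifted to an integral endomorphism and expanded by [galois_onto_order_right]; the reversal
   of products puts the multiplications on the left. *)
have gen (F : 'M[k]_n) : exists b : 'I_n -> 'M[k]_n,
    (forall j, b j \in red_order) /\ F = \sum_(j < n) red_mx (mul j) *m b j.
  have lin : linear (fun y => \sum_(i < n) coord X i y *: lift_vec (F i)).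
    move=> a x y; rewrite scaler_sumr -big_split; apply: eq_bigr => i _ /=.
    by rewrite linearP scalerDl scalerA.
  pose f : {linear L -> L} := HB.pack (fun y => \sum_(i < n) coord X i y *: lift_vec (F i))
    (GRing.isLinear.Build _ _ _ _ _ lin).
  have fO : stable (linfun f).
    move=> y yO; rewrite lfunE; apply: (val_ge_sum hv) => i _.
    by apply: scale_int; rewrite ?coord_int ?lift_vec_int.
  have [h hA hE] := galois_onto_order_right lam_int lam_onto lam_adj fO.
  exists (fun j : 'I_n => red_mx (act (h j))); split=> [j|].
    by apply/red_orderP; exists (h j).
  apply/row_matrixP => i; rewrite raddf_sum.
  have rowE (j : 'I_n) : row i (red_mx (mul j) *m red_mx (act (h j))) =
      red_vec (act (h j) (X`_j * X`_i)).
    rewrite row_mul row_red_mx mulE -red_vecE //; first exact: hA.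
    by rewrite (val_ge0M hv) ?basis_int.
  rewrite (eq_bigr _ (fun j _ => rowE j)).
  rewrite -red_vec_sum => [|j]; last first.
    by apply: hA; apply: (val_ge0M hv); apply: basis_int.
  rewrite -hE lfunE /= (bigD1 i) //= (coord_delta hX) eqxx scale1r big1 ?addr0 => [|j ji].
    by apply/rowP => j; rewrite !mxE coord_lift_vec liftK.
  by rewrite (coord_delta hX) (negPf ji) scale0r.
have [u hu] := finite_cyclic scal add mulB card_red_order gen.
pose x := lift_vec (fun i => u 0 i); have xO : val_ge v 0 x by apply: lift_vec_int.
have /choice[a ha] : forall i : 'I_n, exists h, A h /\ red_vec (act h x) = red_vec X`_i.
  move=> i; have [_ /red_orderP[h hA <-] e] := hu (red_vec X`_i).
  by exists h; split => //; rewrite red_vecE // red_vec_lift e.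
have aA i : A (a i) by case: (ha i).
have aE i : red_vec (act (a i) x) = red_vec X`_i by case: (ha i).
pose Y := [tuple act (a i) x | i < n].
have YE (i : 'I_n) : Y`_i = act (a i) x by rewrite -tnth_nth tnth_mktuple.
(* The reductions of [Y] are the standard basis, so [Y] is residually free. This plays the part of
   Nakayama's lemma: integral elements have integral coordinates along [Y]. *)
have sz : size Y = n := size_tuple Y.
have rfY : residually_free v Y.
  split=> [y /tnthP[i ->]|c cO].
    by rewrite tnth_mktuple; apply: aA.
  move: c cO; rewrite sz => c cO.
  rewrite (eq_bigr (fun i => c i *: act (a i) x)) => [|i _]; last by rewrite YE.
  have sO i : val_ge v 0 (c i *: act (a i) x) by apply: scale_int => //; apply: aA.
  have term j : red_vec (c j *: act (a j) x) = r (c j) *: delta_mx 0 j.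
    rewrite red_vecZ //; last by apply: aA.
    by rewrite aE red_vec_basis.
  rewrite -red_vec_eq0 ?(val_ge_sum hv) // red_vec_sum // => /eqP e i.
  rewrite -(res_eq0 hr) //; apply/eqP; move: e.
  rewrite (eq_bigr _ (fun j _ => term j)) => /rowP/(_ i); rewrite summxE mxE.
  rewrite (bigD1 i) //= !mxE !eqxx mulr1 big1 ?addr0 // => j ji.
  by rewrite !mxE eq_sym (negPf ji) andbF mulr0.
have freeY : free Y := residually_free_free hv rfY.
have basisY : basis_of fullv Y.
  rewrite basisEfree freeY subvf sz /=.
  by rewrite -(span_basis hX) (eqP (basis_free hX)) size_tuple.
exists x; split=> // [y yO|h hx].
  pose c i := coord Y i y.
  have yE : y = \sum_(i < n) c i *: Y`_i by rewrite {1}(coordE basisY y).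
  have cO i : val_ge vK 0 (c i).
    have := @residually_free_coord _ _ _ hv Y _ rfY; rewrite sz => hc.
    by apply: (hc c); rewrite -yE.
  exists (\sum_i c i *: a i); first by apply: order_sum => i; apply: order_scale.
  rewrite [act _]linear_sum sum_lfunE [LHS]yE; apply: eq_bigr => i _.
  by rewrite linearZ scale_lfunE YE.
(* The [a i] are free because their values at [x] are, and [dim_hopf_le] makes them a basis of
   [H]. *)
pose T := [tuple a i | i < n].
have TE (i : 'I_n) : T`_i = a i by rewrite -tnth_nth tnth_mktuple.
have comb0 c : act (\sum_(i < n) c i *: T`_i) x = 0 -> forall i, c i = 0.
  move=> hc; have /freeP fY := freeY; apply: fY; rewrite -[RHS]hc.
  rewrite [act _]linear_sum sum_lfunE; apply: eq_bigr => i _.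
  by rewrite linearZ scale_lfunE YE TE.
have freeT : free T.
  by apply/freeP => c hc; apply: comb0; rewrite hc linear0 zero_lfunE.
have basisT : basis_of fullv T.
  by rewrite basisEfree freeT subvf size_tuple /= (dim_hopf_le hHG hX).
have hE := vector.coord_basis basisT (memvf h).
rewrite hE big1 // => i _; rewrite (comb0 (fun i => coord T i h)) ?scale0r //.
by rewrite -hE.
Qed.

End HopfOrder.
End IntegralStructure.

(** * Freeness of the valuation ring over its associated order *)

Unset Implicit Arguments.
Set Strict Implicit.
Set Printing Implicit Defensive.

Theorem theorem1p1 (p : nat) (p_prime : prime p)
    (Qp : fieldType) (vp : Qp -> rat) (hQp : is_Qp p vp)
    (K : fieldExtType Qp) (L : fieldExtType K)
    (v : L -> rat) (hv : extends_valuation vp v)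
    (hunr : unramified v)
    (H : falgType K) (hs : hopf_structure H)
    (act : {linear H -> 'End(L)}) (hHG : hopf_galois hs act) :
  free_module act (associated_order act (valuation_ring v)) (valuation_ring v).
Proof.
have [vL vE] := hv; have vK := base_valuation vL.
have [t [t0 vt] tK] := uniformizer p_prime hQp vK vE.
(* Every valuation on [L] is attained on [K], so the uniformizer of [K] is one of [L]. *)
have t_unif x : val_gt v 0 x -> val_ge v (v t%:A) x.
  have [-> | x0] := eqVneq x 0; first by rewrite val_ge0.
  have [a a0 va] := hunr x x0; rewrite val_gtE // val_geE // va => a_gt0.
  by have := tK a; rewrite val_gtE // val_geE //; apply.
have [n [X [hX X_int]]] :=
  integral_basis (Qp_valuation hQp) vL vE (Qp_complete hQp) t0 vt t_unif.
have [k [r hr]] := fext_residue_field p_prime hQp vK vE.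
have char0 m : m.+1%:R != 0 :> K.
  by rewrite -(rmorph_nat (in_alg K)) fmorph_eq0 (Qp_natr_neq0 hQp).
have [x [xO x_gen x_free]] :=
  order_cyclic vL t0 vt t_unif hX X_int hr hHG hunr char0.
exists 1%N, (fun=> x); split=> [//|y yO|a aA].
  have [h hA ->] := x_gen y yO.
  by exists (fun=> h); split=> //; rewrite big_ord1.
by rewrite big_ord1 => /x_free a0 i; rewrite ord1.
Qed.
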